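(* Let $d\ge1$ and let $X_1,X_2,\ldots$ be independent random vectors in $\mathbb{R}^d$ with common probability density $f:\mathbb{R}^d\to[0,\infty)$. Assume that $K:\mathbb{R}^d\to\mathbb{R}$ satisfies $K\in L^1(\mathbb{R}^d)\cap L^2(\mathbb{R}^d)$ and $$\int_{\mathbb{R}^d}K(u)\,du=1,\qquad\int_{\mathbb{R}^d}uK(u)\,du=0,\qquad\int_{\mathbb{R}^d}\|u\|^2|K(u)|\,du<\infty,$$ and that $f\in C^{1,1}(\mathbb{R}^d)\cap L^2(\mathbb{R}^d)$ has weak Hessian $D^2f\in L^2(\mathbb{R}^d)$. If $h=h_n>0$ satisfies $h\to0$ and $nh^d\to\infty$ as $n\to\infty$, then $$\operatorname{MISE}(\widehat f_h)=\frac{h^4}{4}\|\mathcal L_Kf\|_2^2+\frac{R(K)}{nh^d}+o\{h^4+(nh^d)^{-1}\},$$ where $\mathcal L_Kf(x)=\operatorname{tr}\{M_2(K)D^2f(x)\}$ and $M_2(K)=\int_{\mathbb{R}^d}uu^\top K(u)\,du$.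
   Context: $C^{1,1}(\mathbb{R}^d)$ is the class of differentiable functions $f:\mathbb{R}^d\to\mathbb{R}$ whose gradient is Lipschitz continuous on $\mathbb{R}^d$. $D^2f\in L^2(\mathbb{R}^d)$ means that all weak second partial derivatives of $f$ belong to $L^2(\mathbb{R}^d)$. The kernel density estimator based on $X_1,\ldots,X_n$ is $\widehat f_h(x)=\frac1{nh^d}\sum_{i=1}^nK\left(\frac{x-X_i}{h}\right)$, $x\in\mathbb{R}^d$, and $\operatorname{MISE}(\widehat f_h)=\mathbb{E}\int_{\mathbb{R}^d}\{\widehat f_h(x)-f(x)\}^2\,dx$. $R(K)=\int_{\mathbb{R}^d}K(u)^2\,du$ and $\|\cdot\|_2$ is the $L^2(\mathbb{R}^d)$ norm. *)

(* Defs.v *)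
From HB Require Import structures.
From mathcomp Require Import all_boot all_order all_algebra.
From mathcomp Require Import all_classical all_reals all_analysis.
From mathcomp Require Import measurable_realfun.

Set Implicit Arguments.
Unset Strict Implicit.
Unset Printing Implicit Defensive.

Import Order.TTheory GRing.Theory Num.Theory.
Import numFieldNormedType.Exports.

Local Open Scope classical_set_scope.
Local Open Scope ring_scope.

(* R^n is 'rV[R]_n, with the sigma-algebra generated by the coordinates
   (the Borel sigma-algebra). *)
Section measurable_rV.
Context {R : realType} (n : nat).

Let coors : 'I_n -> 'rV[R]_n -> R := fun i x => x ord0 i.

Let rV_set0 : g_sigma_preimage coors set0.
Proof. exact: sigma_algebra0. Qed.

Let rV_setC A : g_sigma_preimage coors A -> g_sigma_preimage coors (~` A).
Proof. exact: sigma_algebraC. Qed.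

Let rV_bigcup (F : _^nat) : (forall i, g_sigma_preimage coors (F i)) ->
  g_sigma_preimage coors (\bigcup_i (F i)).
Proof. exact: sigma_algebra_bigcup. Qed.

HB.instance Definition _ := @isMeasurable.Build
  default_measure_display 'rV[R]_n (g_sigma_preimage coors)
  rV_set0 rV_setC rV_bigcup.

Lemma measurable_coord (i : 'I_n) :
  measurable_fun [set: 'rV[R]_n] (fun x : 'rV[R]_n => x ord0 i).
Proof.
move=> _ Y mY; rewrite setTI; apply: sub_sigma_algebra => /=.
rewrite -bigcup_seq/=; exists i => /=; first by rewrite mem_index_enum.
by exists Y => //; rewrite setTI.
Qed.

Lemma measurable_fun_rVP d (T : measurableType d) (f : T -> 'rV[R]_n) :
  measurable_fun [set: T] f <->
  forall i, measurable_fun [set: T] (fun t => f t ord0 i).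
Proof.
split=> [mf i|mf].
  exact: (measurableT_comp (measurable_coord i) mf).
move=> _ A mA; rewrite setTI.
have {mA} : g_sigma_preimage (fun i => coors i \o f) (f @^-1` A).
  by rewrite g_sigma_preimage_comp; exists A => //; rewrite setTI.
apply: smallest_sub; first exact: sigma_algebra_measurable.
rewrite -bigcup_seq; apply: bigcup_sub => i _.
by move=> B [C mC <-]; exact: mf.
Qed.

End measurable_rV.

Section lebesgue_rV.
Context {R : realType}.
Local Open Scope ereal_scope.

(* Iterated-integral construction of the n-fold product of the
   one-dimensional Lebesgue measure. *)
Fixpoint lebesgue_rV (n : nat) : set 'rV[R]_n -> \bar R :=
  match n with
  | 0 => fun A => \d_(0%R : 'rV[R]_0) A
  | n'.+1 => fun A => \int[@lebesgue_measure R]_t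
      lebesgue_rV [set y : 'rV[R]_n' | A (row_mx t%:M y : 'rV[R]_(1 + n'))]
  end.

Let cons_rV n (p : measurableTypeR R * 'rV[R]_n) : 'rV[R]_n.+1 :=
  row_mx (p.1)%:M p.2 : 'rV[R]_(1 + n).

Let cons_rV0 n p : @cons_rV n p ord0 ord0 = p.1.
Proof.
rewrite /cons_rV (_ : ord0 = lshift n (ord0 : 'I_1)); last exact: val_inj.
by rewrite (row_mxEl (p.1)%:M p.2) mxE.
Qed.

Let cons_rVS n p (j : 'I_n) : @cons_rV n p ord0 (lift ord0 j) = p.2 ord0 j.
Proof.
rewrite /cons_rV (_ : lift ord0 j = rshift 1 j); last exact: val_inj.
by rewrite (row_mxEr (p.1)%:M p.2).
Qed.

Let measurable_cons_rV n : measurable_fun [set: _] (@cons_rV n).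
Proof.
apply/measurable_fun_rVP => i.
have [j ->|->] := unliftP ord0 i.
  under eq_fun do rewrite cons_rVS.
  exact: (measurableT_comp (measurable_coord j) measurable_snd).
under eq_fun do rewrite cons_rV0.
exact: measurable_fst.
Qed.

Let lebesgue_rV_sigma_finite_measure n :
  exists m : {sigma_finite_measure set 'rV[R]_n -> \bar R},
    (m : set _ -> \bar R) = @lebesgue_rV n.
Proof.
elim: n => [|n [m mE]]; first by exists (\d_(0%R : 'rV[R]_0)).
pose m1 := (@lebesgue_measure R \x m)%E.
pose q : {measure set 'rV[R]_n.+1 -> \bar R} :=
  measure_function_pushforward__canonical__measure_function_Measure m1
    (@measurable_cons_rV n).
have qE : (q : set _ -> \bar R) = @lebesgue_rV n.+1.
  apply/funext => A; rewrite /q /= /pushforward /m1 /product_measure1 /=.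
  apply: eq_integral => t _; rewrite /= mE; congr lebesgue_rV.
  by apply/seteqP; split => y; rewrite /xsection/= inE.
have qsf : sigma_finite [set: 'rV[R]_n.+1] q.
  have /sigma_finiteP[F [FT ndF Foo]] := sigma_finiteT (@lebesgue_measure R).
  have /sigma_finiteP[G [GT ndG Goo]] := sigma_finiteT m.
  pose tl (x : 'rV[R]_n.+1) : 'rV[R]_n := \row_j x ord0 (lift ord0 j).
  have mtl : measurable_fun setT tl.
    apply/measurable_fun_rVP => j; under eq_fun do rewrite mxE.
    exact: measurable_coord.
  exists (fun k => [set x : 'rV[R]_n.+1 | F k (x ord0 ord0)] `&` tl @^-1` G k).
    apply/seteqP; split => // x _.
    have [i _ Fi] : (\bigcup_i F i) (x ord0 ord0) by rewrite -FT.
    have [j _ Gj] : (\bigcup_j G j) (tl x) by rewrite -GT.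
    exists (maxn i j) => //; split.
    - by have /subsetPset := ndF _ _ (leq_maxl i j); apply.
    - by have /subsetPset := ndG _ _ (leq_maxr i j); apply.
  move=> k; have [mF Fk] := Foo k; have [mG Gk] := Goo k; split.
    apply: measurableI; last by rewrite -[X in measurable X]setTI; exact: mtl.
    by rewrite -[X in measurable X]setTI; exact: measurable_coord.
  rewrite /q /= /pushforward (_ : _ @^-1` _ = F k `*` G k).
    by rewrite /m1 product_measure1E// lte_mul_pinfty// ge0_fin_numE.
  apply/seteqP; split => -[t y] /=; rewrite cons_rV0 (_ : tl _ = y)//;
    by apply/rowP => j; rewrite mxE cons_rVS.
pose qm := Measure_isSigmaFinite.Build _ _ _ q qsf.
pose q' : {sigma_finite_measure set 'rV[R]_n.+1 -> \bar R} :=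
  HB.pack (q : set _ -> \bar R) q qm.
by exists q'.
Qed.

Variable n : nat.

Let lebesgue_rV0 : @lebesgue_rV n set0 = 0.
Proof. by have [m <-] := lebesgue_rV_sigma_finite_measure n. Qed.

Let lebesgue_rV_ge0 A : 0 <= @lebesgue_rV n A.
Proof. by have [m <-] := lebesgue_rV_sigma_finite_measure n. Qed.

Let lebesgue_rV_sigma_additive : semi_sigma_additive (@lebesgue_rV n).
Proof.
have [m <-] := lebesgue_rV_sigma_finite_measure n.
exact: measure_semi_sigma_additive.
Qed.

Let lebesgue_rV_sigma_finite : sigma_finite [set: 'rV[R]_n] (@lebesgue_rV n).
Proof.
by have [m <-] := lebesgue_rV_sigma_finite_measure n; exact: sigma_finiteT.
Qed.

HB.instance Definition _ := isMeasure.Build _ _ _ (@lebesgue_rV n)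
  lebesgue_rV0 lebesgue_rV_ge0 lebesgue_rV_sigma_additive.

HB.instance Definition _ := Measure_isSigmaFinite.Build _ _ _
  (@lebesgue_rV n) lebesgue_rV_sigma_finite.

End lebesgue_rV.
Arguments lebesgue_rV {R} n.

Lemma lebesgue_rV_box (R : realType) (n : nat) (A : 'I_n -> set R) :
  (forall i, measurable (A i)) ->
  lebesgue_rV n [set x | forall i, A i (x ord0 i)] =
  (\prod_(i < n) lebesgue_measure (A i))%E.
Proof.
elim: n A => [|n IHn] A mA.
  by rewrite big_ord0 /= diracE mem_set// => -[].
rewrite big_ord_recl /= -IHn//.
pose c := lebesgue_rV n [set x | forall i, A (lift ord0 i) (x ord0 i)].
have c0 : (0 <= c)%E by exact: measure_ge0.
transitivity (\int[@lebesgue_measure R]_t ((\1_(A ord0) t)%:E * c))%E.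
  apply: eq_integral => t _.
  have r0 (y : 'rV[R]_n) : (row_mx t%:M y : 'rV_(1 + n)) ord0 ord0 = t.
    rewrite (_ : ord0 = lshift n (ord0 : 'I_1)); last exact: val_inj.
    by rewrite (row_mxEl t%:M y) mxE.
  have rS (y : 'rV[R]_n) j :
      (row_mx t%:M y : 'rV_(1 + n)) ord0 (lift ord0 j) = y ord0 j.
    rewrite (_ : lift ord0 j = rshift 1 j); last exact: val_inj.
    by rewrite (row_mxEr t%:M y).
  have [At|At] := pselect (A ord0 t).
    rewrite indicE mem_set// mul1e; congr lebesgue_rV.
    apply/seteqP; split => y /= Ay i; first by have := Ay (lift ord0 i); rewrite rS.
    by have [j ->|->] := unliftP ord0 i; rewrite ?rS ?r0.
  rewrite indicE memNset// mul0e (_ : [set y | _] = set0) ?measure0//.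
  by apply/seteqP; split => y //= Ay; apply: At; have := Ay ord0; rewrite r0.
have m0 : measurable (A ord0 : set (measurableTypeR R)) by exact: mA.
rewrite ge0_integralZr//=; first by rewrite integral_indic// setIT.
  by apply/measurable_EFinP; exact: measurable_indic.
Qed.

Section rV_analysis.
Context {R : realType} {d : nat}.
Implicit Types (f g phi K : 'rV[R]_d -> R).

(* Euclidean norm: the library norm on 'rV[R]_d is the sup norm. *)
Definition enorm (x : 'rV[R]_d) : R := Num.sqrt (\sum_(i < d) x ord0 i ^+ 2).

Definition partial (i : 'I_d) f : 'rV[R]_d -> R :=
  fun x => 'D_(delta_mx ord0 i : 'rV[R]_d) f x.

Definition grad f (x : 'rV[R]_d) : 'rV[R]_d := \row_i partial i f x.

Definition C11 f : Prop :=
  (forall x, differentiable f x) /\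
  exists L : R, forall x y, enorm (grad f x - grad f y) <= L * enorm (x - y).

(* Iterated partial derivatives of all orders exist and are continuous. *)
Definition smooth phi : Prop :=
  forall s : seq 'I_d, let g := foldr partial phi s in
  continuous g /\ forall i x, derivable g x (delta_mx ord0 i : 'rV[R]_d).

Definition test_function phi : Prop :=
  smooth phi /\ compact (closure [set x | phi x != 0]).

(* g is the weak derivative d^2 f / dx_i dx_j, for f and g locally
   integrable. *)
Definition weak_partial2 (i j : 'I_d) f g : Prop :=
  forall phi, test_function phi ->
  \int[lebesgue_rV d]_x (f x * partial i (partial j phi) x) =
  \int[lebesgue_rV d]_x (g x * phi x).

Definition weak_hessian f (D2f : 'rV[R]_d -> 'M[R]_d) : Prop :=
  forall i j, weak_partial2 i j f (fun x => D2f x i j).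

Definition roughness K : R := \int[lebesgue_rV d]_u (K u ^+ 2).

Definition second_moment K : 'M[R]_d :=
  \matrix_(i, j) \int[lebesgue_rV d]_u (u ord0 i * u ord0 j * K u).

Definition LK K (D2f : 'rV[R]_d -> 'M[R]_d) (x : 'rV[R]_d) : R :=
  \tr (second_moment K *m D2f x).

(* The sample X_1, ..., X_n is xs 0, ..., xs n.-1. *)
Definition kde K (h : R) (n : nat) (xs : nat -> 'rV[R]_d) (x : 'rV[R]_d) : R :=
  (n%:R * h ^+ d)^-1 * \sum_(i < n) K (h^-1 *: (x - xs i)).

End rV_analysis.

Section random_vectors.
Context {disp : measure_display} {T : measurableType disp} {R : realType}.
Context (P : probability T R) {d : nat}.
Implicit Types (X : nat -> {RV P >-> 'rV[R]_d}).

Definition mutually_independent X : Prop :=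
  forall (s : seq nat) (A : nat -> set 'rV[R]_d), uniq s ->
  (forall i, measurable (A i)) ->
  P (\bigcap_(i in [set` s]) (X i @^-1` A i)) =
  (\prod_(i <- s) P (X i @^-1` A i))%E.

Definition has_density (Y : {RV P >-> 'rV[R]_d}) (f : 'rV[R]_d -> R) : Prop :=
  forall A : set 'rV[R]_d, measurable A ->
  distribution P Y A = (\int[lebesgue_rV d]_(x in A) (f x)%:E)%E.

(* Valued in \bar R, so that finiteness is not presupposed. *)
Definition MISE X (K f : 'rV[R]_d -> R) (h : R) (n : nat) : \bar R :=
  (\int[P]_w \int[lebesgue_rV d]_x
     ((kde K h n (fun i => X i w) x - f x) ^+ 2)%:E)%E.

End random_vectors.

(* Main.v *)
From HB Require Import structures.
From mathcomp Require Import all_boot all_order all_algebra.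
From mathcomp Require Import all_classical all_reals all_analysis.
From mathcomp Require Import measurable_realfun ring lra.
Require Import Defs.
Set Implicit Arguments.
Unset Strict Implicit.
Unset Printing Implicit Defensive.
Import Order.TTheory GRing.Theory Num.Theory.
Import numFieldNormedType.Exports.
Local Open Scope classical_set_scope.
Local Open Scope ring_scope.

(** The mean integrated squared error splits into an integrated variance and an
    integrated squared bias ([MISE_decomposition]): by Tonelli the expectation
    may be taken first, and at almost every point the estimator is the mean of
    n independent copies of one square integrable variable.  The variance part
    is R(K) / (n h^d) minus the integral of (E f_h)^2 over n.  By Young's
    inequality ([kconv_young]) the subtracted term is O(1/n), which is
    h^d O(1 / (n h^d)), hence negligible.

    For the bias one has to show that
      b_h(x) = int K(u) f(x - h u) du - f(x)
    is (h^2 / 2) L_K f up to o(h^2) in L2 ([bias_expansion]).  The Hessian is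
    only known weakly, so the difference is tested against smooth functions
    phi of compact support.  For a vector v the map
      F(t) = int f(x) phi(x + t v) dx
    is twice differentiable, because f is integrable and phi is smooth, and the
    definition of the weak Hessian, applied to the translates of phi, gives
      F''(t) = sum_ij v_i v_j int D2f_ij(x) phi(x + t v) dx
    ([bump_span_taylor]).  Taylor's formula for F along v = h u, averaged
    against K, loses its first-order term since K has mean zero, and its
    second-order term is the integral of (h^2 / 2) L_K f phi.  The remainder is
    controlled by F''(t) - F''(0), that is, by the L2 norm of phi times the L2
    modulus of continuity of the second derivatives at h u, which tends to 0
    with h ([L2_translation_continuity]); dominated convergence with the
    integrable weight |u|^2 |K(u)| makes the average o(h^2).  Since the smooth
    functions used are dense in L2 ([bump_span_dense]), an estimate uniform in
    phi bounds the L2 norm itself ([nrm2_duality]).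

    The test functions are the linear combinations of products, over the
    coordinates, of one-variable bumps built from exp(-1/t).  Products make
    partial derivatives and compact supports elementary, and suitable bumps
    increase to the indicator function of a box, so that density follows from
    the density of boxes ([L2_density]), a Dynkin-class argument. *)

(** * Integrable and square integrable real functions *)

Section square_integrable.
Context {disp} {T : measurableType disp} {R : realType}.
Variable mu : {measure set T -> \bar R}.
Implicit Types f g : T -> R.

(** Integrability over the whole space of a function with real values. *)
Definition int1 f := mu.-integrable [set: T] (EFin \o f).

(** Membership in L2, in a form that exposes the integrable square. *)
Definition sqint f :=
  measurable_fun [set: T] f /\ int1 (fun x => f x ^+ 2).

Lemma int1_measurable f : int1 f -> measurable_fun [set: T] f.
Proof. by move=> /integrableP[/measurable_EFinP]. Qed.

Lemma int1_le f g : measurable_fun [set: T] f -> int1 g ->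
  (forall x, `|f x| <= `|g x|) -> int1 f.
Proof.
move=> mf ig fg; apply: le_integrable ig => //; first exact/measurable_EFinP.
by move=> x _; rewrite lee_fin.
Qed.

Lemma int1Z a f : int1 f -> int1 (fun x => a * f x).
Proof.
move=> fi; rewrite /int1 (_ : _ \o _ = fun x => (a%:E * (f x)%:E)%E)//.
exact: integrableZl.
Qed.

Lemma int1Zr a f : int1 f -> int1 (fun x => f x * a).
Proof. by move=> fi; under eq_fun do rewrite mulrC; exact: int1Z. Qed.

Lemma int1D f g : int1 f -> int1 g -> int1 (fun x => f x + g x).
Proof.
move=> fi gi; rewrite /int1 (_ : _ \o _ = (EFin \o f) \+ (EFin \o g))%E//.
exact: integrableD.
Qed.

Lemma int1B f g : int1 f -> int1 g -> int1 (fun x => f x - g x).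
Proof.
move=> fi gi; rewrite /int1 (_ : _ \o _ = (EFin \o f) \- (EFin \o g))%E//.
exact: integrableB.
Qed.

Lemma int10 : int1 (fun=> 0).
Proof. exact: integrable0. Qed.

Lemma int1_sum (I : Type) (s : seq I) (F : I -> T -> R) :
  (forall i, int1 (F i)) -> int1 (fun x => \sum_(i <- s) F i x).
Proof.
move=> Fi; elim: s => [|i s IH].
  by under eq_fun do rewrite big_nil; exact: int10.
by under eq_fun do rewrite big_cons; exact: int1D.
Qed.

Lemma int1_norm f : int1 f -> int1 (fun x => `|f x|).
Proof. by move=> fi; have := integrable_norm fi. Qed.

Lemma Rintegral_sum (I : Type) (s : seq I) (F : I -> T -> R) :
  (forall i, int1 (F i)) ->
  \int[mu]_x (\sum_(i <- s) F i x) = \sum_(i <- s) \int[mu]_x F i x.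
Proof.
move=> Fi; elim: s => [|i s IH].
  rewrite big_nil /Rintegral integral0_eq// => x _; by rewrite big_nil.
under eq_Rintegral do rewrite big_cons.
rewrite RintegralD//; [by rewrite big_cons IH|exact: Fi|exact: int1_sum].
Qed.

Lemma int1_EFin f : int1 f ->
  (\int[mu]_x (f x)%:E)%E = (\int[mu]_x f x)%:E.
Proof. by move=> fi; rewrite /Rintegral fineK//; exact: integrable_fin_num. Qed.

Lemma int1_ge0P f : measurable_fun [set: T] f -> (forall x, 0 <= f x) ->
  (\int[mu]_x (f x)%:E < +oo)%E -> int1 f.
Proof.
move=> mf f0 foo; apply/integrableP; split; first exact/measurable_EFinP.
by under eq_integral do rewrite /= ger0_norm//.
Qed.

Lemma int1_bounded f g C : measurable_fun [set: T] g -> int1 f ->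
  (forall x, `|g x| <= C) -> int1 (fun x => f x * g x).
Proof.
move=> mg fi gC; apply: (@int1_le _ (fun x => f x * C)).
- by apply: measurable_funM => //; exact: int1_measurable.
- exact: int1Zr.
- move=> x; rewrite !normrM ler_wpM2l// (le_trans (gC x))// ler_norm//.
Qed.

Lemma le_norm_Rintegral f g : int1 f -> int1 g ->
  (forall x, `|f x| <= g x) -> `|\int[mu]_x f x| <= \int[mu]_x g x.
Proof.
move=> fi gi fg; apply: (le_trans (le_normr_Rintegral _ fi)) => //.
by apply: le_Rintegral => //; exact: int1_norm.
Qed.

Lemma sqintM f g : sqint f -> sqint g -> int1 (fun x => f x * g x).
Proof.
move=> [mf fi] [mg gi]; apply: (@int1_le _ (fun x => f x ^+ 2 + g x ^+ 2)).
- exact: measurable_funM.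
- exact: int1D.
- move=> x; rewrite normrM [leRHS]ger0_norm ?addr_ge0 ?sqr_ge0//.
  rewrite -(real_normK (num_real (f x))) -(real_normK (num_real (g x))).
  have := sqr_ge0 (`|f x| - `|g x|).
  have := normr_ge0 (f x); have := normr_ge0 (g x).
  move: `|f x| `|g x| => a b; nra.
Qed.

Lemma sqintZ a f : sqint f -> sqint (fun x => a * f x).
Proof.
move=> [mf fi]; split; first exact: measurable_funM.
by under eq_fun do rewrite exprMn; exact: int1Z.
Qed.

Lemma sqintD f g : sqint f -> sqint g -> sqint (fun x => f x + g x).
Proof.
move=> [mf fi] [mg gi]; split; first exact: measurable_funD.
have -> : (fun x => (f x + g x) ^+ 2) =
  (fun x => f x ^+ 2 + 2 * (f x * g x) + g x ^+ 2).
  by apply/funext => x; ring.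
by apply: int1D => //; apply: int1D => //; apply: int1Z; exact: sqintM.
Qed.

Lemma sqintB f g : sqint f -> sqint g -> sqint (fun x => f x - g x).
Proof.
move=> sf sg; have := sqintD sf (sqintZ (-1) sg).
by under eq_fun do rewrite mulN1r.
Qed.

Lemma sqint0 : sqint (fun=> 0).
Proof.
by split => //; under eq_fun do rewrite expr0n/=; exact: int10.
Qed.

Lemma sqint_sum (I : Type) (s : seq I) (F : I -> T -> R) :
  (forall i, sqint (F i)) -> sqint (fun x => \sum_(i <- s) F i x).
Proof.
move=> Fi; elim: s => [|i s IH].
  by under eq_fun do rewrite big_nil; exact: sqint0.
by under eq_fun do rewrite big_cons; exact: sqintD.
Qed.

Lemma sqint_le f g : measurable_fun [set: T] f -> sqint g ->
  (forall x, `|f x| <= `|g x|) -> sqint f.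
Proof.
move=> mf [mg gi] fg; split => //.
apply: (int1_le _ gi); first exact: measurable_funX.
by move=> x; rewrite !normrX lerXn2r// nnegrE.
Qed.

Lemma sqint_norm f : sqint f -> sqint (fun x => `|f x|).
Proof.
move=> sf; apply: (sqint_le _ sf).
  by apply: measurableT_comp => //; case: sf.
by move=> x; rewrite normr_id.
Qed.

Lemma RintegralDsq f g t : sqint f -> sqint g ->
  \int[mu]_x ((f x + t * g x) ^+ 2) =
  \int[mu]_x (f x ^+ 2) + 2 * t * \int[mu]_x (f x * g x) +
  t ^+ 2 * \int[mu]_x (g x ^+ 2).
Proof.
move=> sf sg; have fg := sqintM sf sg.
have [_ fi] := sf; have [_ gi] := sg.
have -> : (fun x => (f x + t * g x) ^+ 2) =
  (fun x => (f x ^+ 2 + (2 * t) * (f x * g x)) + t ^+ 2 * (g x ^+ 2)).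
  by apply/funext => x; ring.
rewrite RintegralD//; last 2 first.
- by apply: int1D => //; exact: int1Z.
- exact: int1Z.
by rewrite RintegralD ?RintegralZl//; exact: int1Z.
Qed.

(** The quadratic polynomial t |-> int (f + t g)^2 is nonnegative, so its
    discriminant is not positive. *)
Lemma cauchy_schwarz f g : sqint f -> sqint g ->
  (\int[mu]_x (f x * g x)) ^+ 2 <=
  (\int[mu]_x (f x ^+ 2)) * \int[mu]_x (g x ^+ 2).
Proof.
move=> sf sg.
have key t : 0 <= \int[mu]_x (f x ^+ 2) + 2 * t * \int[mu]_x (f x * g x) +
  t ^+ 2 * \int[mu]_x (g x ^+ 2).
  by rewrite -RintegralDsq//; apply: Rintegral_ge0 => x _; exact: sqr_ge0.
have G0 : 0 <= \int[mu]_x (g x ^+ 2).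
  by apply: Rintegral_ge0 => x _; exact: sqr_ge0.
move: key G0; set A := Rintegral _ _ _; set B := Rintegral _ _ _.
set C := Rintegral _ _ _ => key.
rewrite le_eqVlt => /predU1P[C0|C0].
  have [->|B0] := eqVneq B 0; first by rewrite -C0; nra.
  (* the polynomial is affine: it is -1 at the chosen point unless B = 0 *)
  have := key (- (A + 1) / (2 * B)); rewrite -C0 mulr0 addr0.
  have -> : A + 2 * (- (A + 1) / (2 * B)) * B = -1 by field.
  lra.
have := key (- B / C).
have -> : A + 2 * (- B / C) * B + (- B / C) ^+ 2 * C = A - B ^+ 2 / C.
  by field; exact: lt0r_neq0.
by rewrite subr_ge0 ler_pdivrMr.
Qed.

Lemma Rintegral_sqr_ge0 f : 0 <= \int[mu]_x (f x ^+ 2).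
Proof. by apply: Rintegral_ge0 => x _; exact: sqr_ge0. Qed.

Lemma Rintegral_sqrD_le f g : sqint f -> sqint g ->
  \int[mu]_x ((f x + g x) ^+ 2) <=
  2 * \int[mu]_x (f x ^+ 2) + 2 * \int[mu]_x (g x ^+ 2).
Proof.
move=> sf sg; have [_ fi] := sf; have [_ gi] := sg.
have [_ fgi] := sqintD sf sg.
rewrite -!RintegralZl// -RintegralD//; [|exact: int1Z..].
apply: le_Rintegral => //; first by apply: int1D; exact: int1Z.
by move=> x _; have := sqr_ge0 (f x - g x); nra.
Qed.

Definition nrm2 f : R := Num.sqrt (\int[mu]_x (f x ^+ 2)).

Lemma nrm2_ge0 f : 0 <= nrm2 f. Proof. exact: sqrtr_ge0. Qed.

Lemma nrm2_sqr f : nrm2 f ^+ 2 = \int[mu]_x (f x ^+ 2).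
Proof. by rewrite sqr_sqrtr//; exact: Rintegral_sqr_ge0. Qed.

Lemma cauchy_schwarz_nrm2 f g : sqint f -> sqint g ->
  `|\int[mu]_x (f x * g x)| <= nrm2 f * nrm2 g.
Proof.
move=> sf sg; rewrite -(@ler_pXn2r _ 2)// ?nnegrE ?mulr_ge0 ?nrm2_ge0//.
by rewrite exprMn !nrm2_sqr real_normK ?num_real//; exact: cauchy_schwarz.
Qed.

Lemma Lfun2_sqint f : f \in Lfun mu 2%:E -> sqint f.
Proof.
move=> f2; split; last exact: Lfun2_integrable_sqr.
by have := sub_Lfun_mfun f2; rewrite inE.
Qed.

Lemma Lnorm2_sqr f : sqint f ->
  ('N[mu]_2%:E[EFin \o f] ^+ 2 = (\int[mu]_x (f x ^+ 2))%:E)%E.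
Proof.
move=> [mf fi].
rewrite unlock /Lnorm.
have -> : (\int[mu]_x `|(EFin \o f) x| `^ 2 = (\int[mu]_x (f x ^+ 2))%:E)%E.
  rewrite -int1_EFin//; apply: eq_integral => x _ /=.
  by rewrite powR_mulrn// real_normK ?num_real.
rewrite poweR_EFin powR12_sqrt ?Rintegral_sqr_ge0// -EFin_expe.
by rewrite sqr_sqrtr// Rintegral_sqr_ge0.
Qed.

Lemma int1_dominated_cvg0 (u : nat -> T -> R) (G : T -> R) :
  (forall k, measurable_fun [set: T] (u k)) -> int1 G ->
  (forall k x, `|u k x| <= G x) -> (forall x, u k x @[k --> \oo] --> 0) ->
  \int[mu]_x u k x @[k --> \oo] --> 0.
Proof.
move=> mu_ Gi uG u0.
have := @dominated_convergence _ _ _ mu _ measurableT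
  (fun k x => (u k x)%:E) (fun=> 0%E) (EFin \o G).
case => //.
- by move=> k; exact/measurable_EFinP.
- by apply: aeW => x _; apply: cvg_EFin (u0 x); exact: nearW.
- by apply: aeW => x k _; rewrite lee_fin.
move=> _ _.
by rewrite integral0 => /fine_cvg.
Qed.

Lemma sqint_dominated_cvg0 (u : nat -> T -> R) (G : T -> R) :
  (forall k, measurable_fun [set: T] (u k)) -> sqint G ->
  (forall k x, `|u k x| <= `|G x|) -> (forall x, u k x @[k --> \oo] --> 0) ->
  \int[mu]_x (u k x ^+ 2) @[k --> \oo] --> 0.
Proof.
move=> mu_ [mG Gi] uG u0.
apply: (int1_dominated_cvg0 _ Gi).
- by move=> k; exact: measurable_funX.
- move=> k x; rewrite normrX -[leRHS]real_normK ?num_real//.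
  by rewrite lerXn2r ?nnegrE.
- by move=> x; rewrite -[X in _ --> X](mul0r 0) => *; apply: cvgM.
Qed.

End square_integrable.

(** * Affine changes of variables for Lebesgue measure *)

Section affine1.
Context {R : realType}.
Local Notation leb := (@lebesgue_measure R).

Lemma measurable_affine1 (a b : R) :
  measurable_fun [set: measurableTypeR R]
    (fun t : measurableTypeR R => a * t + b : measurableTypeR R).
Proof. by apply: measurable_funD => //; exact: measurable_funM. Qed.

(** Both sides are measures in A, hence half-open intervals decide. *)
Lemma lebesgue_measure_affine (a b : R) (A : set R) : a != 0 -> measurable A ->
  (`|a|%:E * leb ((fun t => a * t + b)%R @^-1` A))%E = leb A.
Proof.
move=> a0 mA.
pose p : {measure set (measurableTypeR R) -> \bar R} :=
  measure_function_pushforward__canonical__measure_function_Measure leb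
    (@measurable_affine1 a b).
have na0 : 0 <= `|a| by exact: normr_ge0.
pose m : {measure set (measurableTypeR R) -> \bar R} := mscale (NngNum na0) p.
transitivity (m A); first by [].
apply/esym/lebesgue_measure_unique => //= _ [[u v]] _ <-.
rewrite /m /mscale/= /pushforward.
have [an|ap] := ltP a 0.
  have -> : (fun t => a * t + b) @^-1` `]u, v]%classic =
      `[(v - b) / a, (u - b) / a[%classic.
    apply/seteqP; split => t /=; rewrite !in_itv/= ler_ndivrMr// ltr_ndivlMr//;
    by rewrite lerBrDr ltrBlDr andbC (mulrC t).
  rewrite !lebesgue_measure_itv/= !lte_fin ltr_nM2r ?invr_lt0// ltrD2r.
  case: ifPn => uv; last by rewrite mule0.
  by rewrite -!EFinD -EFinM ltr0_norm//; congr EFin; field.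
have {}ap : 0 < a by rewrite lt_def a0.
have -> : (fun t => a * t + b) @^-1` `]u, v]%classic =
    `](u - b) / a, (v - b) / a]%classic.
  apply/seteqP; split => t /=; rewrite !in_itv/= ltr_pdivrMr// ler_pdivlMr//;
  by rewrite lerBrDr ltrBlDr (mulrC t).
rewrite !lebesgue_measure_itv/= !lte_fin ltr_pM2r ?invr_gt0// ltrD2r.
case: ifPn => uv; last by rewrite mule0.
by rewrite -!EFinD -EFinM gtr0_norm//; congr EFin; field.
Qed.

End affine1.

Section affine.
Context {R : realType}.
Local Notation leb := (@lebesgue_measure R).

Lemma measurable_affine n (a : R) (b : 'rV[R]_n) :
  measurable_fun [set: 'rV[R]_n] (fun x : 'rV[R]_n => a *: x + b).
Proof.
apply/measurable_fun_rVP => i; under eq_fun do rewrite !mxE.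
by apply: measurable_funD => //; apply: measurable_funM => //;
  exact: measurable_coord.
Qed.

Lemma row_mx0E n (t : R) (y : 'rV[R]_n) :
  (row_mx t%:M y : 'rV_(1 + n)) ord0 ord0 = t.
Proof.
rewrite (_ : ord0 = lshift n (ord0 : 'I_1)); last exact: val_inj.
by rewrite (row_mxEl t%:M y) mxE.
Qed.

Lemma row_mxSE n (t : R) (y : 'rV[R]_n) j :
  (row_mx t%:M y : 'rV_(1 + n)) ord0 (lift ord0 j) = y ord0 j.
Proof.
rewrite (_ : lift ord0 j = rshift 1 j); last exact: val_inj.
by rewrite (row_mxEr t%:M y).
Qed.

Lemma measurable_row_mx n : measurable_fun [set: measurableTypeR R * 'rV[R]_n]
  (fun p => (row_mx (p.1)%:M p.2 : 'rV[R]_(1 + n)) : 'rV[R]_n.+1).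
Proof.
apply/(@measurable_fun_rVP R n.+1) => i.
have [j ->|->] := unliftP ord0 i.
  under eq_fun do rewrite row_mxSE.
  exact: (measurableT_comp (measurable_coord j) measurable_snd).
under eq_fun do rewrite row_mx0E.
exact: measurable_fst.
Qed.

(** A slice is a section of the preimage of A under the cons map, and sections
    of measurable sets have measurable measure. *)
Lemma measurable_slice n (A : set 'rV[R]_n.+1) : measurable A ->
  measurable_fun [set: measurableTypeR R] (fun t : measurableTypeR R =>
    lebesgue_rV n [set y | A (row_mx t%:M y : 'rV_(1 + n))]).
Proof.
move=> mA; pose B := (fun p : measurableTypeR R * 'rV[R]_n =>
  (row_mx (p.1)%:M p.2 : 'rV[R]_(1 + n)) : 'rV[R]_n.+1) @^-1` A.
have mB : measurable B by rewrite -[B]setTI; exact: (@measurable_row_mx n).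
rewrite (_ : (fun t => _) = lebesgue_rV n \o xsection B).
  exact: measurable_fun_xsection.
apply/funext => t /=; congr lebesgue_rV.
by apply/seteqP; split => y; rewrite /xsection /= inE.
Qed.

(** Slicing off the first coordinate reduces the statement to dimension one. *)
Lemma lebesgue_rV_affine n (a : R) (b : 'rV[R]_n) (A : set 'rV[R]_n) :
  a != 0 -> measurable A ->
  ((`|a| ^+ n)%:E * lebesgue_rV n ((fun x => a *: x + b)%R @^-1` A))%E =
  lebesgue_rV n A.
Proof.
move=> a0; elim: n b A => [|n IH] b A mA.
  rewrite expr0 mul1e; congr (lebesgue_rV 0 _).
  have e (x : 'rV[R]_0) : a *: x + b = x by apply/rowP => -[].
  by apply/seteqP; split => x /=; rewrite e.
pose bt : 'rV[R]_n := \row_j b ord0 (lift ord0 j).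
have cut t (y : 'rV[R]_n) : a *: (row_mx t%:M y : 'rV_(1 + n)) + b =
    (row_mx (a * t + b ord0 ord0)%:M (a *: y + bt) : 'rV_(1 + n)).
  apply/rowP => i; rewrite 2!mxE; have [j ->|->] := unliftP ord0 i.
    by rewrite !row_mxSE !mxE.
  by rewrite !row_mx0E.
pose g (t : measurableTypeR R) :=
  lebesgue_rV n [set y | A (row_mx t%:M y : 'rV_(1 + n))].
have mslice (t : measurableTypeR R) :
    measurable [set y | A (row_mx t%:M y : 'rV_(1 + n))].
  rewrite -[X in measurable X]setTI.
  exact: (measurableT_comp (@measurable_row_mx n) (pair1_measurable t)).
have mg : measurable_fun [set: measurableTypeR R] g by exact: measurable_slice.
have g0 t : (0 <= g t)%E by exact: measure_ge0.
transitivity (\int[leb]_t g t)%E; last by [].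
have -> : (\int[leb]_t g t =
    `|a|%:E * \int[leb]_t g (a * t + b ord0 ord0)%R)%E.
  pose p : {measure set (measurableTypeR R) -> \bar R} :=
    measure_function_pushforward__canonical__measure_function_Measure leb
      (@measurable_affine1 R a (b ord0 ord0)).
  have na0 : 0 <= `|a| by exact: normr_ge0.
  pose m : {measure set (measurableTypeR R) -> \bar R} :=
    mscale (NngNum na0) p.
  transitivity (\int[m]_t g t)%E.
    apply: eq_measure_integral => B mB _.
    exact: (esym (lebesgue_measure_affine (b ord0 ord0) a0 mB)).
  rewrite ge0_integral_mscale//=; congr (_ * _)%E.
  by rewrite ge0_integral_pushforward//; exact: measurable_affine1.
rewrite /= exprS EFinM -muleA; congr (_ * _)%E.
rewrite -ge0_integralZl//; last first.
- have mA' : measurable ((fun x => a *: x + b) @^-1` A).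
    by rewrite -[X in measurable X]setTI; exact: measurable_affine.
  exact: (measurable_slice mA').
apply: eq_integral => t _; rewrite /g -[RHS](IH bt)//; congr (_ * lebesgue_rV n _)%E.
by apply/seteqP; split => y /=; rewrite cut.
Qed.

Lemma ge0_integral_affine n (a : R) (b : 'rV[R]_n) (F : 'rV[R]_n -> \bar R) :
  a != 0 -> measurable_fun [set: 'rV[R]_n] F -> (forall x, (0 <= F x)%E) ->
  ((`|a| ^+ n)%:E * \int[lebesgue_rV n]_x F (a *: x + b)%R =
   \int[lebesgue_rV n]_x F x)%E.
Proof.
move=> a0 mF F0.
pose p : {measure set 'rV[R]_n -> \bar R} :=
  measure_function_pushforward__canonical__measure_function_Measure
    (lebesgue_rV n) (@measurable_affine n a b).
have na0 : 0 <= `|a| ^+ n by exact: exprn_ge0.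
pose m : {measure set 'rV[R]_n -> \bar R} := mscale (NngNum na0) p.
transitivity (\int[m]_x F x)%E.
  rewrite ge0_integral_mscale//=; congr (_ * _)%E.
  by rewrite ge0_integral_pushforward//; exact: measurable_affine.
by apply: eq_measure_integral => B mB _; exact: lebesgue_rV_affine.
Qed.

Lemma int1_affine n (a : R) (b : 'rV[R]_n) (F : 'rV[R]_n -> R) : a != 0 ->
  int1 (lebesgue_rV n) F -> int1 (lebesgue_rV n) (fun x => F (a *: x + b)).
Proof.
move=> a0 Fi; have mF := int1_measurable Fi.
have an0 : 0 < `|a| ^+ n by rewrite exprn_gt0// normr_gt0.
move: Fi => /integrableP[_ Foo]; apply/integrableP; split.
  apply/measurable_EFinP; apply: measurableT_comp => //.
  exact: measurable_affine.
move: Foo; rewrite -(ge0_integral_affine b a0)//; last first.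
  by apply: measurableT_comp => //; exact/measurable_EFinP.
rewrite !ltey; apply: contra => /eqP ->.
by rewrite gt0_muley ?lte_fin.
Qed.

Lemma Rintegral_affine n (a : R) (b : 'rV[R]_n) (F : 'rV[R]_n -> R) :
  a != 0 -> int1 (lebesgue_rV n) F ->
  `|a| ^+ n * \int[lebesgue_rV n]_x F (a *: x + b) =
   \int[lebesgue_rV n]_x F x.
Proof.
move=> a0 Fi; have mF := int1_measurable Fi.
have mE : measurable_fun [set: 'rV[R]_n] (EFin \o F) by exact/measurable_EFinP.
apply: EFin_inj; rewrite EFinM -!int1_EFin//; last exact: int1_affine.
have Ti := int1_affine b a0 Fi.
have -> : (\int[lebesgue_rV n]_x (F (a *: x + b)%R)%:E =
    \int[lebesgue_rV n]_x (EFin \o F)^\+ (a *: x + b)%R -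
    \int[lebesgue_rV n]_x (EFin \o F)^\- (a *: x + b)%R)%E.
  by rewrite integralE; congr (_ - _)%E; apply: eq_integral => x _; rewrite unlock.
rewrite [RHS]integralE.
rewrite -(ge0_integral_affine b a0 (measurable_funepos mE))//.
rewrite -(ge0_integral_affine b a0 (measurable_funeneg mE))//.
rewrite muleBr//; apply: fin_num_adde_defr.
have := integrable_pos_fin_num measurableT Ti.
by congr (_ \is a fin_num); apply: eq_integral => x _; rewrite unlock.
Qed.

Lemma sqint_affine n (a : R) (b : 'rV[R]_n) (F : 'rV[R]_n -> R) : a != 0 ->
  sqint (lebesgue_rV n) F -> sqint (lebesgue_rV n) (fun x => F (a *: x + b)).
Proof.
move=> a0 [mF Fi]; split; last exact: (int1_affine b a0 Fi).
by apply: measurableT_comp => //; exact: measurable_affine.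
Qed.

End affine.

(** * Indicator functions of boxes span L2 *)

Section boxes.
Context {R : realType} {d : nat}.
Local Notation rV := 'rV[R]_d.
Local Notation leb := (lebesgue_rV d).

Definition box (a b : 'I_d -> R) : set rV :=
  [set x | forall i, a i < x ord0 i < b i].

Lemma measurable_rect (A : 'I_d -> set R) : (forall i, measurable (A i)) ->
  measurable [set x : rV | forall i, A i (x ord0 i)].
Proof.
move=> mA.
have -> : [set x : rV | forall i, A i (x ord0 i)] =
    \bigcap_(i in [set: 'I_d]) ((fun x : rV => x ord0 i) @^-1` A i).
  by apply/seteqP; split => [x Ax i _|x Ax i]; [exact: Ax|exact: (Ax i)].
apply: fin_bigcap_measurable => // i _.
by have := @measurable_coord R d i measurableT _ (mA i); rewrite setTI.
Qed.

Lemma boxE a b : box a b = [set x : rV | forall i, `]a i, b i[%classic (x ord0 i)].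
Proof. by apply/seteqP; split => x xab i; have := xab i; rewrite /= in_itv. Qed.

Lemma measurable_box a b : measurable (box a b).
Proof. by rewrite boxE; exact: (@measurable_rect (fun i => `]a i, b i[%classic)). Qed.

Lemma box_fin a b : (leb (box a b) < +oo)%E.
Proof.
rewrite boxE (@lebesgue_rV_box R d (fun i => `]a i, b i[%classic))//.
suff /andP[] : (0 <= \prod_(i < d) lebesgue_measure `]a i, b i[%classic)%E &&
  (\prod_(i < d) lebesgue_measure `]a i, b i[%classic < +oo)%E by [].
elim/big_rec: _ => [|i y _ /andP[y0 yoo]]; first by rewrite lee_fin ler01 ltry.
have : (lebesgue_measure `]a i, b i[%classic < +oo)%E.
  by rewrite lebesgue_measure_itv/=; case: ifP; rewrite -?EFinD ?ltry.
by move=> abi; rewrite mule_ge0//= lte_mul_pinfty// ge0_fin_numE.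
Qed.

Lemma int1_indic A : measurable A -> (leb A < +oo)%E -> int1 leb (\1_A : rV -> R).
Proof.
move=> mA Aoo; apply/integrableP; split.
  by apply/measurable_EFinP; exact: measurable_indic.
under eq_integral do rewrite /= ger0_norm//.
by rewrite integral_indic// setIT.
Qed.

Lemma indic_sqr (A : set rV) x : (\1_A x : R) ^+ 2 = \1_A x.
Proof. by rewrite indicE; case: (x \in A); rewrite ?expr1n ?expr0n. Qed.

Lemma sqint_indic A : measurable A -> (leb A < +oo)%E -> sqint leb (\1_A : rV -> R).
Proof.
move=> mA Aoo; split; first exact: measurable_indic.
by under eq_fun do rewrite indic_sqr; exact: int1_indic.
Qed.

Lemma sqint_indicI A a b : measurable A -> sqint leb (\1_(A `&` box a b) : rV -> R).
Proof.
move=> mA; apply: sqint_indic; first by apply: measurableI => //; exact: measurable_box.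
apply: le_lt_trans (box_fin a b); apply: le_measure; rewrite ?inE//.
- by apply: measurableI => //; exact: measurable_box.
- exact: measurable_box.
Qed.

(** A generating class of the Borel sets that is stable under intersection and
    whose members meet a box in a box. *)
Definition upper_orthants : set (set rV) :=
  [set A | exists a : 'I_d -> R, A = [set x : rV | forall i, a i < x ord0 i]].

Lemma upper_orthantsI : setI_closed upper_orthants.
Proof.
move=> _ _ [a ->] [b ->]; exists (fun i => Num.max (a i) (b i)).
apply/seteqP; split => x /=.
  by move=> [xa xb] i; rewrite gt_max xa xb.
by move=> xab; split => i; have := xab i; rewrite gt_max => /andP[].
Qed.

Lemma measurable_upper_orthants :
  (measurable : set (set rV)) = <<s upper_orthants >>.
Proof.
apply/seteqP; split; last first.
  apply: smallest_sub; first exact: sigma_algebra_measurable.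
  move=> _ [a ->].
  rewrite (_ : [set x | _] = [set x : rV | forall i, `]a i, +oo[%classic (x ord0 i)]).
    exact: (@measurable_rect (fun i => `]a i, +oo[%classic)).
  by apply/seteqP; split => x xa i; have := xa i; rewrite /= in_itv/= andbT.
have mc (i : 'I_d) : measurable_fun [set: g_sigma_algebraType upper_orthants]
    (fun x : g_sigma_algebraType upper_orthants => (x : rV) ord0 i : measurableTypeR R).
  apply: (measurability _ (RGenOInfty.measurableE R)).
  move=> _ [_ [a ->] <-]; rewrite setTI.
  (* a half-space is the union of orthants whose other bounds tend to -oo *)
  have -> : (fun x : g_sigma_algebraType upper_orthants => (x : rV) ord0 i) @^-1`
      `]a, +oo[%classic =
      \bigcup_n [set x : rV | forall j, (if j == i then a else - n%:R) < x ord0 j].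
    apply/seteqP; split => x /=; rewrite in_itv/= andbT; last first.
      by move=> [n _ /(_ i)]; rewrite eqxx.
    move=> xa; pose M := \sum_j `|x ord0 j|.
    exists (Num.truncn M).+1 => //= j; case: eqP => [->//|_].
    rewrite ltrNl (le_lt_trans _ (truncnS_gt _))//.
    rewrite (le_trans (ler_norm _))// normrN /M (bigD1 j)//= lerDl sumr_ge0//.
  apply: bigcup_measurable => n _; apply: sub_sigma_algebra.
  by exists (fun j => if j == i then a else - n%:R).
apply: smallest_sub; first exact: smallest_sigma_algebra.
rewrite -bigcup_seq; apply: bigcup_sub => i _.
by move=> B [C mC <-]; exact: mc.
Qed.

End boxes.

Section box_density.
Context {R : realType} {d : nat}.
Local Notation rV := 'rV[R]_d.
Local Notation leb := (lebesgue_rV d).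
Variable V : (rV -> R) -> Prop.
Hypothesis V_lin : forall a f g, V f -> V g -> V (fun x => f x + a * g x).
Hypothesis V_box : forall a b, V \1_(box a b).
Hypothesis V_closed : forall g, sqint leb g ->
  (forall e, 0 < e -> exists v, [/\ sqint leb v, V v &
     \int[leb]_x ((g x - v x) ^+ 2) <= e]) -> V g.

Let V_0 : V (fun=> 0).
Proof.
rewrite (_ : (fun=> 0) = fun x => \1_(box (fun=> 0) (fun=> 0)) x +
  (-1) * \1_(box (fun=> 0) (fun=> 0)) x); first exact: V_lin.
by apply/funext => x; rewrite mulN1r subrr.
Qed.

Let V_sum (I : Type) (s : seq I) (c : I -> R) (F : I -> rV -> R) :
  (forall i, V (F i)) -> V (fun x => \sum_(i <- s) c i * F i x).
Proof.
move=> VF; elim: s => [|i s IH].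
  by under eq_fun do rewrite big_nil; exact: V_0.
by under eq_fun do rewrite big_cons addrC; exact: V_lin.
Qed.

Let V_cvg (g : rV -> R) (v : nat -> rV -> R) : sqint leb g ->
  (forall k, sqint leb (v k)) -> (forall k, V (v k)) ->
  \int[leb]_x ((g x - v k x) ^+ 2) @[k --> \oo] --> 0 -> V g.
Proof.
move=> sg sv Vv /cvgrPdist_le vg; apply: V_closed => // e e0.
have [k _ /(_ k (leqnn k))] := vg e e0.
rewrite sub0r normrN ger0_norm ?Rintegral_sqr_ge0// => vke.
by exists (v k).
Qed.

(** Dynkin's lemma; cutting with a box keeps all the sets, complements
    included, of finite measure. *)
Let V_cut (a b : 'I_d -> R) A : measurable A -> V \1_(A `&` box a b).
Proof.
rewrite measurable_upper_orthants; move: A.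
apply: (@dynkin_induction _ _ (@upper_orthants R d)
  (fun A => V \1_(A `&` box a b))).
- exact: measurable_upper_orthants.
- exact: upper_orthantsI.
- by rewrite setTI; exact: V_box.
- move=> _ [c ->].
  rewrite (_ : _ `&` _ = box (fun i => Num.max (a i) (c i)) b).
    exact: V_box.
  apply/seteqP; split => x /=.
    by move=> [xc xab] i; have /andP[ax xb] := xab i; rewrite /= gt_max ax xb; have := xc i => /= ->.
  by move=> xab; split => i; have := xab i; rewrite /= gt_max => /andP[/andP[ax cx] xb];
    rewrite ?ax.
- move=> S mS VS.
  rewrite (_ : \1_ _ = fun x => \1_(box a b) x + (-1) * \1_(S `&` box a b) x).
    exact: V_lin.
  apply/funext => x; rewrite !indicE !in_setI in_setC.
  by case: (x \in S); case: (x \in box _ _) => /=; lra.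
- move=> F mF tF VF.
  have mU : measurable (\bigcup_k F k) by exact: bigcup_measurable.
  (* a disjoint union is the L2 limit of its finite subunions *)
  pose v m (x : rV) : R := \sum_(k <- iota 0 m) 1 * \1_(F k `&` box a b) x.
  have sF k : sqint leb (\1_(F k `&` box a b) : rV -> R) by exact: sqint_indicI.
  have vE m x : v m x = if x \in box a b then (\sum_(k < m) (x \in F k)%:R) else 0.
    rewrite /v; case: ifPn => xB.
      rewrite -(big_mkord xpredT (fun k => (x \in F k)%:R)) /index_iota subn0.
      by apply: eq_bigr => k _; rewrite mul1r indicE in_setI xB andbT.
    by apply: big1 => k _; rewrite mul1r indicE in_setI (negbTE xB) andbF.
  have v1 m x k : F k x -> \sum_(j < m) (x \in F j)%:R = (k < m)%:R :> R.
    move=> Fkx; have [km|mk] := ltnP k m.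
      rewrite (bigD1 (Ordinal km))//= mem_set// big1 ?addr0// => j jk.
      rewrite memNset// => Fjx; move/eqP: jk; apply; apply: val_inj => /=.
      by apply: (tF _ _ I I); exists x.
    rewrite big1// => j _; rewrite memNset// => Fjx.
    have := ltn_ord j; rewrite (_ : val j = k) ?ltnNge ?mk//.
    by apply: (tF _ _ I I); exists x.
  have v0 m x : ~ (\bigcup_k F k) x -> \sum_(j < m) (x \in F j)%:R = 0 :> R.
    move=> nF; rewrite big1// => j _; rewrite memNset// => Fjx; apply: nF.
    by exists j.
  apply: (V_cvg (v := v)).
  + exact: sqint_indicI.
  + by move=> m; apply: sqint_sum => k; apply: sqintZ; exact: sF.
  + by move=> m; apply: V_sum => k; exact: VF.
  + apply: (@sqint_dominated_cvg0 _ _ _ leb _ (\1_(box a b) : rV -> R)).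
    * move=> m; apply: measurable_funB; first by apply: measurable_indic;
        apply: measurableI => //; exact: measurable_box.
      by have [] := sqint_sum (iota 0 m) (fun k => sqintZ 1 (sF k)).
    * by apply: sqint_indic; [exact: measurable_box|exact: box_fin].
    * move=> m x; rewrite vE indicE in_setI indicE; case: ifPn => xB; last first.
        by rewrite andbF subrr normr0.
      rewrite andbT normr1; have [[k _ Fkx]|nF] := pselect ((\bigcup_k F k) x).
        rewrite mem_set; last by exists k.
        by rewrite (v1 _ _ _ Fkx); case: (_ < _)%N;
          rewrite ?subrr ?subr0 ?normr0 ?normr1// ler01.
      by rewrite memNset// v0// subrr normr0.
    * move=> x; have [[k _ Fkx]|nF] := pselect ((\bigcup_k F k) x).
        apply: cvg_near_cst; near=> m; rewrite vE indicE in_setI mem_set; last by exists k.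
        rewrite (v1 _ _ _ Fkx) (_ : (k < m)%N) /=; last by near: m; exact: nbhs_infty_gt.
        by case: (x \in _); rewrite subrr.
      apply: cvg_near_cst; near=> m; rewrite vE indicE in_setI memNset//= v0//.
      by case: (x \in _); rewrite subrr.
Unshelve. all: by end_near. Qed.

Let cube (k : nat) : set rV := box (fun=> - k%:R) (fun=> k%:R).

Let cube_cover x : \forall k \near \oo, cube k x.
Proof.
near=> k => i.
have xk : `|x ord0 i| < k%:R.
  apply: (@le_lt_trans _ _ (\sum_j `|x ord0 j|)).
    by rewrite (bigD1 i)//= lerDl sumr_ge0.
  by near: k; exact: nbhs_infty_gtr.
by have := xk; rewrite ltr_norml.
Unshelve. all: by end_near. Qed.

Import HBNNSimple.

Let V_ge0 (g : rV -> R) : sqint leb g -> (forall x, 0 <= g x) -> V g.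
Proof.
move=> sg g0; have [mg _] := sg.
have mE : measurable_fun [set: rV] (EFin \o g) by exact/measurable_EFinP.
pose f := nnsfun_approx measurableT mE.
have fg k x : f k x <= g x.
  rewrite -lee_fin /f nnsfun_approxE.
  by apply: (@le_approx _ _ _ setT (EFin \o g) k x) => // y _; rewrite lee_fin.
pose v k x := f k x * \1_(cube k) x.
have v0 k x : 0 <= v k x by rewrite mulr_ge0.
have vg k x : v k x <= g x.
  rewrite /v indicE; case: (_ \in _); rewrite ?mulr1 ?mulr0//.
have mv k : measurable_fun [set: rV] (v k).
  apply: measurable_funM; first exact: measurable_funPT.
  by apply: measurable_indic; exact: measurable_box.
apply: (V_cvg (v := v)) => //.
- move=> k; apply: (sqint_le (mv k) sg) => x.
  by rewrite !ger0_norm.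
- move=> k; rewrite (_ : v k = fun x => \sum_(y <- finmap.enum_fset (fset_set (range (f k))))
      y * \1_(f k @^-1` [set y] `&` cube k) x).
    by apply: V_sum => y; exact: V_cut.
  apply/funext => x; rewrite /v fimfunE fsbig_finite//= big_distrl/=.
  by apply: eq_bigr => y _; rewrite -mulrA !indicE in_setI -natrM mulnb.
- apply: (sqint_dominated_cvg0 _ sg).
  + by move=> k; exact: measurable_funB.
  + move=> k x; rewrite !ger0_norm ?subr_ge0//.
    by rewrite lerBlDr lerDl.
  + move=> x; rewrite -(subrr (g x)); apply: cvgB; first exact: cvg_cst.
    have fx : f k x @[k --> \oo] --> g x.
      have : (EFin \o f ^~ x) k @[k --> \oo] --> (EFin \o g) x.
        by apply: (cvg_nnsfun_approx measurableT mE) => // y _; rewrite lee_fin.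
      by move=> /fine_cvg.
    apply: cvg_trans fx; apply: near_eq_cvg; near=> k.
    by rewrite /v indicE mem_set ?mulr1//; near: k; exact: cube_cover.
Unshelve. all: by end_near. Qed.

(** Simple functions cut by large cubes approximate a nonnegative function from
    below; the general case follows by splitting g into its positive and
    negative parts. *)
Theorem L2_density g : sqint leb g -> V g.
Proof.
move=> sg; have [mg _] := sg.
have sn := sqint_norm sg.
have sp : sqint leb (fun x => 2^-1 * (`|g x| + g x)).
  by apply: sqintZ; exact: sqintD.
have sm : sqint leb (fun x => 2^-1 * (`|g x| + -1 * g x)).
  by apply: sqintZ; apply: sqintD => //; exact: sqintZ.
have -> : g = fun x => 2^-1 * (`|g x| + g x) + (-1) * (2^-1 * (`|g x| + -1 * g x)).
  by apply/funext => x; lra.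
apply: V_lin; apply: V_ge0 => // x; rewrite mulr_ge0// ?invr_ge0//.
  by rewrite -[X in _ + X]opprK subr_ge0 -normrN ler_norm.
by rewrite mulN1r subr_ge0 ler_norm.
Qed.

End box_density.

(** * Smooth bumps of one variable *)

Section smooth_one_variable.
Context {R : realType}.
Implicit Types f g : R -> R.

Lemma is_derive1D f g (x a b : R) : is_derive x 1 f a -> is_derive x 1 g b ->
  is_derive x 1 (fun t => f t + g t) (a + b).
Proof. by move=> fa gb; exact: (@is_deriveD _ _ _ f g x 1 a b). Qed.

Lemma is_derive1M f g (x a b : R) : is_derive x 1 f a -> is_derive x 1 g b ->
  is_derive x 1 (fun t => f t * g t) (a * g x + f x * b).
Proof.
move=> fa gb; have H : is_derive x 1 (f * g) (f x *: b + g x *: a).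
  exact: is_deriveM.
by apply: is_derive_eq H _; rewrite addrC (mulrC a).
Qed.

Lemma is_derive1Z f (x a k : R) : is_derive x 1 f a ->
  is_derive x 1 (fun t => k * f t) (k * a).
Proof. by move=> fa; exact: (@is_deriveZ _ _ _ f k x 1 a). Qed.

Lemma is_derive1_affine (a b x : R) : is_derive x 1 (fun t => a * t + b) a.
Proof.
rewrite -[X in is_derive _ _ _ X]addr0; apply: is_derive1D.
rewrite -[X in is_derive _ _ _ X]mulr1; exact: is_derive1Z.
Qed.

Lemma is_derive1_inj f (x a b : R) :
  is_derive x 1 f a -> is_derive x 1 f b -> a = b.
Proof. by move=> [_ <-] [_ <-]. Qed.

(** The class C_b^n of functions whose first n derivatives exist and are bounded.
    The derivative is an existential witness, which makes the closure properties
    below plain inductions on n. *)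
Fixpoint Cb (n : nat) f : Prop :=
  (exists C, forall x, `|f x| <= C) /\
  match n with
  | 0 => True
  | n'.+1 => exists2 f' : R -> R, (forall x : R, is_derive x 1 f (f' x)) & Cb n' f'
  end.

Definition Cbinf f := forall n, Cb n f.

Lemma CbW n f : Cb n.+1 f -> Cb n f.
Proof.
elim: n f => [|n IH] f [bf [f' df Cf']]; first by split.
by split => //; exists f' => //; exact: IH.
Qed.

Lemma CbD n f g : Cb n f -> Cb n g -> Cb n (fun x => f x + g x).
Proof.
elim: n f g => [|n IH] f g [[C fC] Hf] [[D gD] Hg]; split.
- exists (C + D) => x; rewrite (le_trans (ler_normD _ _))// lerD//.
- by [].
- exists (C + D) => x; rewrite (le_trans (ler_normD _ _))// lerD//.
- case: Hf => f' df Cf'; case: Hg => g' dg Cg'.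
  exists (fun x => f' x + g' x); last exact: IH.
  by move=> x; exact: is_derive1D.
Qed.

(** Leibniz' rule f' g + f g' only involves products of functions of C_b^n. *)
Lemma CbM n f g : Cb n f -> Cb n g -> Cb n (fun x => f x * g x).
Proof.
have bM f0 g0 C D : (forall x, `|f0 x| <= C) -> (forall x, `|g0 x| <= D) ->
    exists E, forall x : R, `|f0 x * g0 x| <= E :> R.
  by move=> fC gD; exists (C * D) => x; rewrite normrM ler_pM.
elim: n f g => [|n IH] f g [[C fC] Hf] [[D gD] Hg]; split => //.
- exact: (bM _ _ C D).
- exact: (bM _ _ C D).
- have Cf : Cb n f by apply: CbW; split => //; exists C.
  have Cg : Cb n g by apply: CbW; split => //; exists D.
  case: Hf => f' df Cf'; case: Hg => g' dg Cg'.
  exists (fun x => f' x * g x + f x * g' x).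
    by move=> x; exact: is_derive1M.
  by apply: CbD; exact: IH.
Qed.

Lemma Cb_cst n (k : R) : Cb n (fun=> k).
Proof.
elim: n k => [|n IH] k; split => //; try by exists `|k|.
by exists (fun=> 0) => // x; exact: is_derive_cst.
Qed.

Lemma Cb_affine n f (a b : R) : Cb n f -> Cb n (fun t => f (a * t + b)).
Proof.
elim: n f => [|n IH] f [[C fC] Hf]; split => //; try by exists C.
case: Hf => f' df Cf'; exists (fun t => f' (a * t + b) * a).
  move=> x; exact: (@is_derive1_comp _ f (fun t => a * t + b) x _ a
    (df (a * x + b)) (is_derive1_affine a b x)).
by apply: CbM; [exact: IH|exact: Cb_cst].
Qed.

Lemma Cbinf_derive1 f : Cbinf f ->
  (forall x : R, is_derive x 1 f (derive1 f x)) /\ Cbinf (derive1 f).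
Proof.
move=> Cf; have [_ [f' df _]] := Cf 1%N.
have f'E : derive1 f = f' by apply/funext => x; rewrite derive1E; case: (df x).
rewrite f'E; split => // n; have [_ [f1 df1 Cf1]] := Cf n.+1.
rewrite (_ : f' = f1)//; apply/funext => x; exact: is_derive1_inj (df x) (df1 x).
Qed.

Lemma Cbinf_bounded f : Cbinf f -> exists C, forall x, `|f x| <= C.
Proof. by move=> /(_ 0%N)[]. Qed.

Lemma is_derive1_continuous f f' : (forall x : R, is_derive x 1 f (f' x)) ->
  continuous f.
Proof.
move=> df x; apply: differentiable_continuous.
by apply/derivable1_diffP; case: (df x).
Qed.

Lemma Cbinf_continuous f : Cbinf f -> continuous f.
Proof. by move=> /Cbinf_derive1[df _]; exact: is_derive1_continuous df. Qed.

(** The whole family in m is needed: the derivative of t^-m exp(-1/t) is a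
    combination of two later members, so that the family is smooth as soon as
    each member is differentiable once. *)
Definition flat (m : nat) (t : R) : R :=
  if 0 < t then t^-1 ^+ m * expR (- t^-1) else 0.

(** One term of the exponential series is at most the exponential. *)
Lemma powexp_le m (y : R) : 0 < y -> y ^+ m * expR (- y) <= m`!%:R.
Proof.
move=> y0; rewrite expRN ler_pdivrMr ?expR_gt0//.
case: m => [|m]; first by rewrite expr0 fact0 mul1r (le_trans _ (expR_ge1Dx _))// lerDl ltW.
rewrite mulrC -ler_pdivrMr ?ltr0n ?fact_gt0//.
by apply: le_trans (expR_ge1Dxn m (ltW y0)); rewrite lerDr.
Qed.

Lemma flat_ge0 m t : 0 <= flat m t.
Proof.
by rewrite /flat; case: ifP => // t0; rewrite mulr_ge0 ?expR_ge0// exprn_ge0// invr_ge0 ltW.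
Qed.

Lemma flat_le m t : flat m t <= m`!%:R.
Proof. by rewrite /flat; case: ifP => // t0; rewrite powexp_le// invr_gt0. Qed.

(** At 0 the difference quotient on the right is h * flat (m + 2) h, and
    [flat] is bounded. *)
Lemma is_derive_flat m (t : R) :
  is_derive t 1 (flat m) (- m%:R * flat m.+1 t + flat m.+2 t).
Proof.
have [t0|t0|t0] := ltgtP t 0.
- rewrite [flat m.+1 t]/flat [flat m.+2 t]/flat !ltNge (ltW t0)/= mulr0 addr0.
  have H : \near t, 0 = flat m t.
    near=> s; rewrite /flat ltNge ltW//=; near: s; exact: lt_nbhsl.
  exact: near_eq_is_derive H (is_derive_cst (0 : R) t 1).
- rewrite [flat m.+1 t]/flat [flat m.+2 t]/flat t0.
  have H : \near t, t^-1 ^+ m * expR (- t^-1) = flat m t.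
    near=> s; rewrite /flat ifT//; near: s; exact: lt_nbhsr.
  apply: near_eq_is_derive H _.
  have dV : is_derive t 1 (fun y : R => y^-1) (- t ^- 2).
    have := @is_deriveV _ id t 1 1 (lt0r_neq0 t0) (is_derive_id _ _).
    by rewrite [_ *: _]mulr1.
  have dX : is_derive t 1 (fun y : R => y^-1 ^+ m) (m%:R * t^-1 ^+ m.-1 * - t ^- 2).
    rewrite (_ : (fun y => _) = (fun y : R => y^-1) ^+ m).
      exact: (@is_deriveX _ _ (fun y : R => y^-1) m t 1 _ dV).
    by apply/funext => y; rewrite exprfctE.
  have dE : is_derive t 1 (fun y : R => expR (- y^-1)) (expR (- t^-1) * t ^- 2).
    have dN : is_derive t 1 (fun y : R => - y^-1) (t ^- 2).
      rewrite -[X in is_derive _ _ _ X]opprK.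
      exact: (@is_deriveN _ _ _ (fun y : R => y^-1) t 1 _ dV).
    exact: (@is_derive1_comp _ expR (fun y => - y^-1) t _ _
      (is_derive_expR _) dN).
  apply: (is_derive_eq (is_derive1M dX dE)).
  have -> : t ^- 2 = t^-1 ^+ 2 by rewrite exprVn.
  move: (t^-1) (expR _) => y E.
  case: m {dX} => [|m]; rewrite ?mul0r ?oppr0 ?add0r ?mul0r ?add0r.
    by rewrite expr0; ring.
  by rewrite /= !exprS; ring.
- rewrite t0 {2 3}/flat ltxx mulr0 addr0.
  suff H : h^-1 * (flat m (h + 0) - flat m 0) @[h --> 0^'] --> (0 : R).
    have H' : h^-1 *: (flat m (h *: 1 + 0) - flat m 0) @[h --> 0^'] --> (0 : R).
      apply: cvg_trans H; apply: near_eq_cvg; near=> h.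
      by rewrite [h *: 1]mulr1.
    by split; [apply/cvg_ex; exists 0|exact/cvg_lim].
  rewrite {2}/flat ltxx.
  apply/cvgrPdist_le => /= e e0; near=> h.
  rewrite sub0r normrN subr0 addr0 /flat.
  case: ifP => h0; last by rewrite mulr0 normr0 ltW.
  have -> : h^-1 * (h^-1 ^+ m * expR (- h^-1)) = h * flat m.+2 h.
    by rewrite /flat h0 mulrA mulrA !exprS !mulrA divff ?mul1r// lt0r_neq0.
  rewrite normrM (ger0_norm (flat_ge0 _ _)) gtr0_norm//.
  apply: (@le_trans _ _ (h * m.+2`!%:R)).
    by rewrite ler_wpM2l ?flat_le// ltW.
  rewrite -ler_pdivlMr ?ltr0n ?fact_gt0//.
  rewrite (le_trans (ler_norm _))//; near: h.
  apply: dnbhs0_le.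
  by rewrite divr_gt0// ltr0n fact_gt0.
Unshelve. all: by end_near. Qed.

Lemma Cbinf_flat m : Cbinf (flat m).
Proof.
move=> n; elim: n m => [|n IH] m; (split; first by exists m`!%:R => t;
  rewrite ger0_norm ?flat_ge0// flat_le) => //.
exists (fun t => - m%:R * flat m.+1 t + flat m.+2 t).
  by move=> t; exact: is_derive_flat.
by apply: CbD => //; apply: CbM => //; exact: Cb_cst.
Qed.

(** As k grows this tends to the indicator function of ]a, b[, since
    exp(-1/(k t)) tends to 1 for t > 0.  It stays between 0 and 1 without being
    normalised. *)
Definition bump1 (a b : R) (k : nat) (t : R) : R :=
  flat 0 (k.+1%:R * (t - a)) * flat 0 (k.+1%:R * (b - t)).

Lemma Cbinf_bump1 a b k : Cbinf (bump1 a b k).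
Proof.
move=> n; apply: CbM.
  rewrite (_ : (fun t => _) = fun t => flat 0 (k.+1%:R * t + k.+1%:R * - a)).
    by apply: Cb_affine; exact: Cbinf_flat.
  by apply/funext => t; rewrite mulrBr mulrN.
rewrite (_ : (fun t => _) = fun t => flat 0 (- k.+1%:R * t + k.+1%:R * b)).
  by apply: Cb_affine; exact: Cbinf_flat.
by apply/funext => t; rewrite mulrBr mulNr addrC.
Qed.

Lemma bump1_out a b k t : ~~ (a < t < b) -> bump1 a b k t = 0.
Proof.
rewrite negb_and -!leNgt /bump1 /flat => /orP[ta|bt].
  by rewrite [X in X * _]ifF ?mul0r// pmulr_rgt0 ?ltr0n// subr_gt0 ltNge ta.
by rewrite mulrC [X in X * _]ifF ?mul0r// pmulr_rgt0 ?ltr0n// subr_gt0 ltNge bt.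
Qed.

Lemma flat0_le1 t : flat 0 t <= 1.
Proof. exact: (flat_le 0 t). Qed.

Lemma bump1_ge0 a b k t : 0 <= bump1 a b k t.
Proof. by rewrite mulr_ge0// flat_ge0. Qed.

Lemma bump1_le1 a b k t : bump1 a b k t <= 1.
Proof. by rewrite mulr_ile1 ?flat_ge0 ?flat0_le1. Qed.

Lemma flat0_cvg (t : R) : 0 < t -> flat 0 (k.+1%:R * t) @[k --> \oo] --> (1 : R).
Proof.
move=> t0.
have -> : (fun k => flat 0 (k.+1%:R * t)) = (fun k => expR (- (t^-1 * harmonic k))).
  apply/funext => k; rewrite /flat mulr_gt0 ?ltr0n// expr0 mul1r.
  by rewrite invfM mulrC.
rewrite -[X in _ --> X]expR0.
apply: (@cvg_comp _ _ _ (fun k => - (t^-1 * harmonic k)) expR _ (nbhs (0 : R))).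
  rewrite -oppr0 -(mulr0 t^-1); apply: cvgN.
  by apply: cvgM; [exact: cvg_cst|exact: cvg_harmonic].
exact: continuous_expR.
Qed.

Lemma bump1_cvg a b t : a < t < b -> bump1 a b k t @[k --> \oo] --> (1 : R).
Proof.
move=> /andP[at_ tb]; rewrite -[X in _ --> X](mulr1 1).
by apply: cvgM; apply: flat0_cvg; rewrite subr_gt0.
Qed.

End smooth_one_variable.

(** * Product test functions *)

Section products.
Context {R : realType} {d : nat}.
Local Notation rV := 'rV[R]_d.
Local Notation leb := (lebesgue_rV d).
Implicit Types (g : 'I_d -> R -> R) (x v : rV).

(** A partial derivative acts on a single factor of such a product.  The family
    is therefore stable under partial derivatives, and its derivatives along
    lines follow from Leibniz' rule instead of a multivariate chain rule. *)
Definition prodf g x : R := \prod_i g i (x ord0 i).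

Definition der_at (i : 'I_d) g : 'I_d -> R -> R :=
  fun j => if j == i then derive1 (g j) else g j.

Lemma Cbinf_der_at i g : (forall j, Cbinf (g j)) -> forall j, Cbinf (der_at i g j).
Proof.
by move=> Cg j; rewrite /der_at; case: ifP => // _; have [] := Cbinf_derive1 (Cg j).
Qed.

Lemma is_derive1_prod (I : eqType) (s : seq I) (G G' : I -> R -> R) (t : R) :
  uniq s -> (forall i, is_derive t 1 (G i) (G' i t)) ->
  is_derive t 1 (fun t => \prod_(i <- s) G i t)
    (\sum_(i <- s) \prod_(j <- s) (if j == i then G' j t else G j t)).
Proof.
move=> + dG; elim: s => [_|i s IH /= /andP[si us]].
  rewrite big_nil; under eq_fun do rewrite big_nil; exact: is_derive_cst.
under eq_fun do rewrite big_cons.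
apply: (is_derive_eq (is_derive1M (dG i) (IH us))).
rewrite big_cons; congr (_ + _).
  rewrite big_cons eqxx; congr (_ * _).
  apply: eq_big_seq => j js; case: eqP => // ji.
  by move: si; rewrite -ji js.
rewrite big_distrr/=; apply: eq_big_seq => j js; rewrite big_cons.
by case: eqP => // ij; move: si; rewrite ij js.
Qed.

(** The chain rule along the line through x directed by v. *)
Lemma is_derive_prodf g x v (t : R) : (forall j, Cbinf (g j)) ->
  is_derive t 1 (fun t => prodf g (x + t *: v))
    (\sum_i v ord0 i * prodf (der_at i g) (x + t *: v)).
Proof.
move=> Cg; rewrite /prodf.
pose G i (t : R) := g i (v ord0 i * t + x ord0 i).
pose G' i (t : R) := derive1 (g i) (v ord0 i * t + x ord0 i) * v ord0 i.
have E i (s : R) : (x + s *: v) ord0 i = v ord0 i * s + x ord0 i.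
  by rewrite !mxE addrC mulrC.
have dG i : is_derive t 1 (G i) (G' i t).
  have [dg _] := Cbinf_derive1 (Cg i).
  exact: (@is_derive1_comp _ (g i) (fun t => v ord0 i * t + x ord0 i) t _ _
    (dg _) (is_derive1_affine (v ord0 i) (x ord0 i) t)).
have -> : (fun t => \prod_i g i ((x + t *: v) ord0 i)) =
    (fun t => \prod_(i <- index_enum 'I_d) G i t).
  by apply/funext => s; apply: eq_bigr => i _; rewrite E.
have H := is_derive1_prod (index_enum_uniq 'I_d) dG.
apply: (is_derive_eq H); apply: eq_bigr => i _.
rewrite [LHS](bigD1 i)//= [X in _ = _ * X](bigD1 i)//= !eqxx /der_at eqxx /G' E.
rewrite [RHS]mulrA [X in _ = X * _]mulrC; congr (_ * _).
by apply: eq_bigr => j /negbTE ->; rewrite E.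
Qed.

Lemma is_derive_line (phi : rV -> R) x v (a : R) :
  is_derive (0 : R) 1 (fun t => phi (x + t *: v)) a -> is_derive x v phi a.
Proof.
have E : (fun t => phi (x + t *: v)) = (fun t : R => phi (t *: v + x)).
  by apply/funext => t; rewrite addrC.
have E2 : (fun h : R => h^-1 *: ((phi \o shift x) (h *: v) - phi x)) =
    (fun h : R => h^-1 *: (((fun t : R => phi (t *: v + x)) \o shift 0) (h *: 1) -
       phi (0 *: v + x))).
  by apply/funext => t /=; rewrite addr0 scale0r add0r [t *: 1]mulr1.
by rewrite E => -[dphi <-]; split; rewrite ?/derivable ?/derive E2.
Qed.

Lemma is_derive_delta_prodf g x i : (forall j, Cbinf (g j)) ->
  is_derive x (delta_mx ord0 i) (prodf g) (prodf (der_at i g) x).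
Proof.
move=> Cg; apply: is_derive_line.
apply: (is_derive_eq (is_derive_prodf x (delta_mx ord0 i) 0 Cg)).
rewrite (bigD1 i)//= big1 ?addr0 => [|j ji].
  by rewrite mxE !eqxx mul1r scale0r addr0.
by rewrite mxE eqxx (negbTE ji) mul0r.
Qed.

Lemma partial_prodf g i : (forall j, Cbinf (g j)) ->
  partial i (prodf g) = prodf (der_at i g).
Proof.
by move=> Cg; apply/funext => x; have [_] := is_derive_delta_prodf x i Cg.
Qed.

Lemma prodf_bounded g : (forall j, Cbinf (g j)) -> exists C, forall x, `|prodf g x| <= C.
Proof.
move=> Cg.
have /choice[C gC] : forall i, exists C, forall t, `|g i t| <= C.
  by move=> i; exact: Cbinf_bounded.
exists (\prod_i C i) => x; rewrite /prodf normr_prod.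
by apply: ler_prod => i _; rewrite normr_ge0 gC.
Qed.

Lemma prodf_measurable g : (forall j, Cbinf (g j)) ->
  measurable_fun [set: rV] (prodf g).
Proof.
move=> Cg; apply: measurable_prod => i _.
exact: (measurableT_comp (continuous_measurable_fun (Cbinf_continuous (Cg i)))
  (measurable_coord i)).
Qed.

Lemma prodf_continuous g : (forall j, Cbinf (g j)) -> continuous (prodf g).
Proof.
move=> Cg.
suff H s : continuous (fun x : rV => \prod_(i <- s) g i (x ord0 i)) by exact: H.
elim: s => [|i s IH] x.
  rewrite (_ : (fun x => _) = fun=> 1); first exact: cst_continuous.
  by apply/funext => y; rewrite big_nil.
rewrite (_ : (fun x => _) =
    fun x : rV => g i (x ord0 i) * \prod_(i <- s) g i (x ord0 i)).
  have cc : {for x, continuous (fun x : rV => x ord0 i)} by exact: coord_continuous.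
  have cg : {for x ord0 i, continuous (g i)} by exact: Cbinf_continuous.
  exact: (continuousM (continuous_comp cc cg) (IH x)).
by apply/funext => y; rewrite big_cons.
Qed.

(** Every iterated partial derivative of a product is a product of the same kind. *)
Lemma smooth_prodf g : (forall j, Cbinf (g j)) -> smooth (prodf g).
Proof.
move=> Cg s.
have [g' [Cg' E]] : exists g', (forall j, Cbinf (g' j)) /\
    foldr partial (prodf g) s = prodf g'.
  elim: s => [|i s [g' [Cg' E]]]; first by exists g.
  exists (der_at i g'); split; first exact: Cbinf_der_at.
  by rewrite /= E; exact: partial_prodf.
rewrite /= E; split; first exact: prodf_continuous.
by move=> i x; have [] := is_derive_delta_prodf x i Cg'.
Qed.

Definition supported g (a b : 'I_d -> R) : Prop :=
  (forall j, Cbinf (g j)) /\ (forall i t, ~~ (a i < t < b i) -> g i t = 0).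

Lemma prodf_out g a b x : supported g a b -> ~ box a b x -> prodf g x = 0.
Proof.
move=> [_ g0] /existsNP[i /negP xi]; rewrite /prodf (bigD1 i)//= g0 ?mul0r//.
Qed.

Lemma prodf_test_function g a b : supported g a b -> test_function (prodf g).
Proof.
move=> sg; split; first by apply: smooth_prodf; case: sg.
have cK : compact [set x : rV | forall i, `[a i, b i]%classic (x ord0 i)].
  by apply: (@rV_compact _ _ (fun i => `[a i, b i]%classic)) => i; exact: segment_compact.
apply: (subclosed_compact _ cK); first exact: closed_closure.
apply: (@subset_trans _ (closure [set x : rV | forall i, `[a i, b i]%classic (x ord0 i)])).
  apply: closureS => x /= /eqP gx; apply: contrapT => xab; apply: gx.
  apply: (prodf_out sg) => bx; apply: xab => i; rewrite /= in_itv/=.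
  by have /andP[/ltW -> /ltW ->] := bx i.
rewrite -(closure_id _).1//; apply: compact_closed cK; exact: norm_hausdorff.
Qed.

Lemma supported_shift g a b v : supported g a b ->
  supported (fun i t => g i (1 * t + v ord0 i))
    (fun i => a i - v ord0 i) (fun i => b i - v ord0 i).
Proof.
move=> [Cg g0]; split=> [j n|i t ab]; first by apply: Cb_affine; exact: Cg.
by rewrite mul1r g0//; apply: contra ab; rewrite ltrBlDr ltrBrDr.
Qed.

Lemma prodf_shift g v x :
  prodf (fun i t => g i (1 * t + v ord0 i)) x = prodf g (x + v).
Proof. by apply: eq_bigr => i _; rewrite mul1r mxE. Qed.

Lemma derive1_shift (h : R -> R) (c : R) : Cbinf h ->
  derive1 (fun t => h (1 * t + c)) = fun t => derive1 h (1 * t + c).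
Proof.
move=> Ch; apply/funext => t; rewrite [LHS]derive1E.
have [dh _] := Cbinf_derive1 Ch.
have [_ ->] := @is_derive1_comp _ h (fun t => 1 * t + c) t _ _
    (dh _) (is_derive1_affine 1 c t).
by rewrite mulr1.
Qed.

Lemma der_at_shift g v i : (forall j, Cbinf (g j)) ->
  der_at i (fun j t => g j (1 * t + v ord0 j)) =
  fun j t => der_at i g j (1 * t + v ord0 j).
Proof.
by move=> Cg; apply/funext => j; rewrite /der_at; case: ifP => // _; exact: derive1_shift.
Qed.

(** The weak Hessian is tested against translates of products, which are
    themselves products; this computes the derivatives that appear. *)
Lemma partial2_shift g v i j x : (forall j, Cbinf (g j)) ->
  partial i (partial j (prodf (fun i t => g i (1 * t + v ord0 i)))) x =
  prodf (der_at i (der_at j g)) (x + v).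
Proof.
move=> Cg; have Cs h : (forall j, Cbinf (h j)) ->
    forall j, Cbinf (fun t => h j (1 * t + v ord0 j)).
  by move=> Ch k n; apply: Cb_affine; exact: Ch.
rewrite partial_prodf; last exact: Cs.
rewrite der_at_shift// partial_prodf; last by apply: Cs; exact: Cbinf_der_at.
by rewrite der_at_shift ?prodf_shift//; exact: Cbinf_der_at.
Qed.

Lemma prodf_le_indic g a b : supported g a b ->
  exists2 C, 0 <= C & forall x, `|prodf g x| <= C * \1_(box a b) x.
Proof.
move=> sg; have [C gC] := prodf_bounded (sg.1).
exists `|C|; first exact: normr_ge0.
move=> x; have [xab|xab] := pselect (box a b x).
  by rewrite indicE mem_set// mulr1 (le_trans (gC x))// ler_norm.
by rewrite (prodf_out sg xab) normr0 mulr_ge0.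
Qed.

Lemma prodf_int1 g a b : supported g a b -> int1 leb (prodf g).
Proof.
move=> sg; have [C C0 gC] := prodf_le_indic sg.
apply: (@int1_le _ _ _ _ _ (fun x => C * \1_(box a b) x)).
- by apply: prodf_measurable; case: sg.
- apply: int1Z; apply: int1_indic; [exact: measurable_box|exact: box_fin].
- by move=> x; rewrite (le_trans (gC x))// ler_norm.
Qed.

Lemma prodf_sqint g a b : supported g a b -> sqint leb (prodf g).
Proof.
move=> sg; have [C C0 gC] := prodf_le_indic sg.
apply: (@sqint_le _ _ _ _ _ (fun x => C * \1_(box a b) x)).
- by apply: prodf_measurable; case: sg.
- apply: sqintZ; apply: sqint_indic; [exact: measurable_box|exact: box_fin].
- by move=> x; rewrite (le_trans (gC x))// ler_norm.
Qed.

(** Mean value theorem on the segment from x to x + v. *)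
Lemma prodf_lipschitz g : (forall j, Cbinf (g j)) ->
  exists2 C, 0 <= C & forall x v,
    `|prodf g (x + v) - prodf g x| <= C * \sum_i `|v ord0 i|.
Proof.
move=> Cg.
have /choice[C gC] : forall i, exists C, forall x, `|prodf (der_at i g) x| <= C.
  by move=> i; apply: prodf_bounded; exact: Cbinf_der_at.
have C0 i : 0 <= C i by rewrite (le_trans _ (gC i 0)).
exists (\sum_i C i); first exact: sumr_ge0.
move=> x v.
have dF t := is_derive_prodf x v t Cg.
have [c _] := @MVT_segment _ _ _ 0 1 ler01 (fun t _ => dF t)
  (continuous_subspaceT (is_derive1_continuous dF)).
rewrite scale1r scale0r addr0 subr0 mulr1 => ->.
rewrite (le_trans (ler_norm_sum _ _ _))// mulr_sumr ler_sum// => i _.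
rewrite normrM mulrC ler_wpM2r// (le_trans (gC i _))//.
by rewrite (bigD1 i)//= lerDl sumr_ge0.
Qed.

End products.

(** * Density of the product test functions and continuity of translations *)

Section bump_span.
Context {R : realType} {d : nat}.
Local Notation rV := 'rV[R]_d.
Local Notation leb := (lebesgue_rV d).
Implicit Types (phi : rV -> R) (x v : rV).

Inductive bump_span : (rV -> R) -> Prop :=
| bump_span_prodf g a b : supported g a b -> bump_span (prodf g)
| bump_span_lin c phi psi : bump_span phi -> bump_span psi ->
    bump_span (fun x => phi x + c * psi x).

Lemma bump_span_bounded phi : bump_span phi -> exists C, forall x, `|phi x| <= C.
Proof.
elim=> [g a b [Cg _]|c f g _ [C fC] _ [D gD]]; first exact: prodf_bounded.
exists (C + `|c| * D) => x; rewrite (le_trans (ler_normD _ _))// lerD//.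
by rewrite normrM ler_wpM2l.
Qed.

Lemma bump_span_int1 phi : bump_span phi -> int1 leb phi.
Proof.
elim=> [g a b sg|c f g _ If _ Ig]; first exact: prodf_int1 sg.
by apply: int1D => //; exact: int1Z.
Qed.

Lemma bump_span_sqint phi : bump_span phi -> sqint leb phi.
Proof.
elim=> [g a b sg|c f g _ If _ Ig]; first exact: prodf_sqint sg.
by apply: sqintD => //; exact: sqintZ.
Qed.

Lemma addv_affine (phi : rV -> R) v : (fun x => phi (x + v)) = fun x => phi (1 *: x + v).
Proof. by apply/funext => x; rewrite scale1r. Qed.

Lemma sqint_shift (phi : rV -> R) v : sqint leb phi -> sqint leb (fun x => phi (x + v)).
Proof. by move=> sp; rewrite addv_affine; apply: sqint_affine => //; exact: oner_neq0. Qed.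

Lemma int1_shift (phi : rV -> R) v : int1 leb phi -> int1 leb (fun x => phi (x + v)).
Proof. by move=> sp; rewrite addv_affine; apply: int1_affine => //; exact: oner_neq0. Qed.

Lemma Rintegral_shift (phi : rV -> R) v : int1 leb phi ->
  \int[leb]_x phi (x + v) = \int[leb]_x phi x.
Proof.
move=> ip; rewrite -(Rintegral_affine v (oner_neq0 R) ip) normr1 expr1n mul1r.
by rewrite addv_affine.
Qed.

(** A bounded increment is squared by bounding one factor by the Lipschitz
    estimate and integrating the other one. *)
Lemma bump_span_translation phi : bump_span phi -> exists2 C, 0 <= C &
  forall v, \int[leb]_x ((phi (x + v) - phi x) ^+ 2) <= C * \sum_i `|v ord0 i|.
Proof.
elim=> [g a b sg|c f g sf [C C0 fC] sg [D D0 gD]].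
  have [C C0 gC] := prodf_lipschitz sg.1.
  have gi := prodf_int1 sg; have gn := int1_norm gi.
  pose N := \int[leb]_x `|prodf g x|.
  have N0 : 0 <= N by exact: Rintegral_ge0.
  exists (C * (2 * N)); first by rewrite !mulr_ge0.
  move=> v; have gvi := int1_shift v gi; have gvn := int1_shift v gn.
  pose S := C * \sum_i `|v ord0 i|.
  apply: (@le_trans _ _ (\int[leb]_x (S * (`|prodf g (x + v)| + `|prodf g x|)))).
    apply: le_Rintegral => //.
    - apply: (@int1_le _ _ _ _ _ (fun x => S * (`|prodf g (x + v)| + `|prodf g x|))).
      + by apply: measurable_funX; apply: measurable_funB;
          [exact: int1_measurable gvi|exact: int1_measurable gi].
      + by apply: int1Z; exact: int1D.
      + move=> x; rewrite ger0_norm ?sqr_ge0// (le_trans _ (ler_norm _))//.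
        rewrite -real_normK ?num_real// expr2; apply: ler_pM => //.
        exact: ler_normB.
    - by apply: int1Z; exact: int1D.
    - move=> x _; rewrite -real_normK ?num_real// expr2; apply: ler_pM => //.
      exact: ler_normB.
  rewrite RintegralZl//; last exact: int1D.
  rewrite RintegralD// (Rintegral_shift v gn) -/N /S.
  by rewrite le_eqVlt; apply/orP; left; apply/eqP; ring.
exists (2 * C + 2 * (c ^+ 2 * D)); first by apply: addr_ge0; [|apply: mulr_ge0 => //]; rewrite mulr_ge0 ?sqr_ge0.
move=> v.
have ssf := bump_span_sqint sf; have ssg := bump_span_sqint sg.
have dsf := sqintB (sqint_shift v ssf) ssf.
have dsg := sqintB (sqint_shift v ssg) ssg.
have -> : (fun x => (f (x + v) + c * g (x + v) - (f x + c * g x)) ^+ 2) =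
  (fun x => ((f (x + v) - f x) + c * (g (x + v) - g x)) ^+ 2).
  by apply/funext => x; ring.
apply: (le_trans (Rintegral_sqrD_le dsf (sqintZ c dsg))).
under [X in _ + 2 * X]eq_Rintegral do rewrite exprMn.
rewrite RintegralZl//; last by case: dsg.
rewrite [leRHS]mulrDl; apply: lerD; first by rewrite -mulrA ler_wpM2l.
have := ler_wpM2l (sqr_ge0 c) (gD v); rewrite mulrA; lra.
Qed.

Definition box_bump (a b : 'I_d -> R) (k : nat) : 'I_d -> R -> R :=
  fun i => bump1 (a i) (b i) k.

Lemma box_bump_supported a b k : supported (box_bump a b k) a b.
Proof.
split=> [j|i t]; first exact: Cbinf_bump1.
exact: bump1_out.
Qed.

Lemma prod_cvg1 (u : 'I_d -> nat -> R) : (forall i, u i k @[k --> \oo] --> (1 : R)) ->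
  \prod_i u i k @[k --> \oo] --> (1 : R).
Proof.
move=> u1.
suff H s : \prod_(i <- s) u i k @[k --> \oo] --> (1 : R) by exact: H.
elim: s => [|i s IH].
  rewrite (_ : (fun k => _) = fun=> 1); first exact: cvg_cst.
  by apply/funext => k; rewrite big_nil.
rewrite (_ : (fun k => _) = fun k => u i k * \prod_(i <- s) u i k).
  by rewrite -[X in _ --> X](mulr1 1); exact: cvgM.
by apply/funext => k; rewrite big_cons.
Qed.

Definition bump_approx (g : rV -> R) : Prop := sqint leb g /\
  forall e, 0 < e -> exists2 phi, bump_span phi &
    \int[leb]_x ((g x - phi x) ^+ 2) <= e.

Lemma bump_approx_box a b : bump_approx \1_(box a b).
Proof.
have sB : sqint leb (\1_(box a b) : rV -> R).
  by apply: sqint_indic; [exact: measurable_box|exact: box_fin].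
split=> // e e0.
have : \int[leb]_x ((\1_(box a b) x - prodf (box_bump a b k) x) ^+ 2)
    @[k --> \oo] --> (0 : R).
  apply: (sqint_dominated_cvg0 _ sB).
  - move=> k; apply: measurable_funB; first by case: sB.
    by apply: prodf_measurable; case: (box_bump_supported a b k).
  - move=> k x; have [xab|xab] := pselect (box a b x).
      rewrite indicE mem_set// normr1 ger0_norm ?subr_ge0.
        by rewrite lerBlDr lerDl; apply: prodr_ge0 => i _; exact: bump1_ge0.
      rewrite /prodf; apply: prodr_ile1 => i _.
      by rewrite bump1_ge0 bump1_le1.
    by rewrite (prodf_out (box_bump_supported a b k) xab) indicE memNset// subr0.
  - move=> x; have [xab|xab] := pselect (box a b x); last first.
      apply: cvg_near_cst; apply: nearW => k.
      by rewrite (prodf_out (box_bump_supported a b k) xab) indicE memNset// subr0.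
    rewrite indicE mem_set// -(subrr 1); apply: cvgB; first exact: cvg_cst.
    by apply: prod_cvg1 => i; apply: bump1_cvg; exact: xab.
move=> /cvgrPdist_le /(_ e e0)[k _ /(_ k (leqnn k))].
rewrite sub0r normrN ger0_norm ?Rintegral_sqr_ge0// => ke.
exists (prodf (box_bump a b k)) => //.
exact: bump_span_prodf (box_bump_supported a b k).
Qed.

(** The functions that are approximated by the span satisfy the hypotheses of
    [L2_density]. *)
Theorem bump_span_dense g e : sqint leb g -> 0 < e ->
  exists2 phi, bump_span phi & \int[leb]_x ((g x - phi x) ^+ 2) <= e.
Proof.
move=> sg; suff [_] : bump_approx g by apply.
apply: (L2_density _ _ _ sg) => {g e sg}.
- move=> c f g [sf fA] [sg gA]; split; first by apply: sqintD => //; exact: sqintZ.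
  move=> e e0.
  have e4 : 0 < e / 4 by rewrite divr_gt0.
  have c1 : 0 < c ^+ 2 + 1 by rewrite ltr_wpDl ?sqr_ge0.
  have ec : 0 < e / 4 / (c ^+ 2 + 1) by rewrite divr_gt0.
  have [p sp fp] := fA _ e4; have [q sq gq] := gA _ ec.
  exists (fun x => p x + c * q x); first exact: bump_span_lin.
  have ssp := sqintB sf (bump_span_sqint sp).
  have ssq := sqintB sg (bump_span_sqint sq).
  have -> : (fun x => (f x + c * g x - (p x + c * q x)) ^+ 2) =
    (fun x => ((f x - p x) + c * (g x - q x)) ^+ 2) by apply/funext => x; ring.
  apply: (le_trans (Rintegral_sqrD_le ssp (sqintZ c ssq))).
  under [X in _ + 2 * X]eq_Rintegral do rewrite exprMn.
  rewrite RintegralZl//; last by case: ssq.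
  have : c ^+ 2 * \int[leb]_x ((g x - q x) ^+ 2) <= e / 4.
    apply: (@le_trans _ _ (c ^+ 2 * (e / 4 / (c ^+ 2 + 1)))).
      by rewrite ler_wpM2l ?sqr_ge0.
    rewrite mulrA ler_pdivrMr// mulrC ler_wpM2l ?(ltW e4)//.
    by rewrite lerDl.
  move: fp; lra.
- exact: bump_approx_box.
- move=> g sg gA; split => // e e0.
  have e4 : 0 < e / 4 by rewrite divr_gt0.
  have [w [sw [_ wA] gw]] := gA _ e4.
  have [p sp wp] := wA _ e4; exists p => //.
  have -> : (fun x => (g x - p x) ^+ 2) =
    (fun x => ((g x - w x) + (w x - p x)) ^+ 2) by apply/funext => x; ring.
  apply: (le_trans (Rintegral_sqrD_le (sqintB sg sw)
    (sqintB sw (bump_span_sqint sp)))).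
  by move: gw wp; lra.
Qed.

(** It holds for the dense class by [bump_span_translation], and translations
    are isometries, so that it passes to L2 limits. *)
Theorem L2_translation_continuity g e : sqint leb g -> 0 < e ->
  exists2 delta, 0 < delta & forall v, \sum_i `|v ord0 i| <= delta ->
    \int[leb]_x ((g (x + v) - g x) ^+ 2) <= e.
Proof.
move=> sg e0; have e8 : 0 < e / 16 by rewrite divr_gt0.
have [p sp gp] := bump_span_dense sg e8.
have [C C0 pC] := bump_span_translation sp.
have C1 : 0 < C + 1 by rewrite ltr_wpDl.
(* (x + y + z)^2 <= 4 x^2 + 4 y^2 + 2 z^2 leaves room for constants e / 16 *)
exists (e / 16 / (C + 1)); first by rewrite divr_gt0.
move=> v vd; have sgp := sqintB sg (bump_span_sqint sp).
have spv := sqintB (sqint_shift v (bump_span_sqint sp)) (bump_span_sqint sp).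
have -> : (fun x => (g (x + v) - g x) ^+ 2) =
    (fun x => (((g (x + v) - p (x + v)) + (-1) * (g x - p x)) + (p (x + v) - p x)) ^+ 2).
  by apply/funext => x; ring.
have sgpv := sqint_shift v sgp.
apply: (le_trans (Rintegral_sqrD_le (sqintD sgpv (sqintZ (-1) sgp)) spv)).
have := Rintegral_sqrD_le sgpv (sqintZ (-1) sgp).
under [X in _ <= _ + 2 * X -> _]eq_Rintegral do rewrite exprMn sqrrN expr1n mul1r.
have [_ igp] := sgp.
rewrite (Rintegral_shift v igp).
have : C * \sum_i `|v ord0 i| <= e / 16.
  apply: (@le_trans _ _ (C * (e / 16 / (C + 1)))); first by rewrite ler_wpM2l.
  by rewrite mulrA ler_pdivrMr// mulrC ler_wpM2l ?(ltW e8)// lerDl.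
move: (pC v) gp; lra.
Qed.

End bump_span.

(** * Taylor expansion against test functions *)

Section taylor.
Context {R : realType}.

Lemma is_derive1_sum (I : Type) (s : seq I) (F : I -> R -> R) (F' : I -> R) (t : R) :
  (forall i, is_derive t 1 (F i) (F' i)) ->
  is_derive t 1 (fun t => \sum_(i <- s) F i t) (\sum_(i <- s) F' i).
Proof.
move=> dF; elim: s => [|i s IH].
  rewrite big_nil; under eq_fun do rewrite big_nil; exact: is_derive_cst.
by under eq_fun do rewrite big_cons; rewrite big_cons; exact: is_derive1D.
Qed.

(** Mean value theorem applied twice, to F minus its Taylor polynomial and then
    to the derivative of the difference.  The sharp bound would be B / 2. *)
Lemma taylor2 (F F1 F2 : R -> R) (B : R) :
  (forall t : R, is_derive t 1 F (F1 t)) -> (forall t : R, is_derive t 1 F1 (F2 t)) ->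
  (forall t, 0 <= t <= 1 -> `|F2 t - F2 0| <= B) ->
  `|F 1 - F 0 - F1 0 - 2^-1 * F2 0| <= B.
Proof.
move=> dF dF1 F2B.
pose H (t : R) := F1 t + (- F2 0 * t + - F1 0).
have dH (t : R) : is_derive t 1 H (F2 t + - F2 0).
  by apply: is_derive1D => //; exact: is_derive1_affine.
pose G (t : R) := F t + (- (2^-1 * F2 0) * (t * t) + (- F1 0 * t + 0)).
have dG (t : R) : is_derive t 1 G (H t).
  have d2 := is_derive1Z (- (2^-1 * F2 0))
    (is_derive1M (is_derive_id t (1 : R)) (is_derive_id t (1 : R))).
  apply: (is_derive_eq (is_derive1D (dF t)
    (is_derive1D d2 (is_derive1_affine (- F1 0) 0 t)))).
  by rewrite /H /=; lra.
have [c] := @MVT_segment _ G H 0 1 ler01 (fun t _ => dG t)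
  (continuous_subspaceT (is_derive1_continuous dG)).
rewrite in_itv/= => /andP[c0 c1] GE.
have [e] := @MVT_segment _ H (fun t => F2 t + - F2 0) 0 c c0 (fun t _ => dH t)
  (continuous_subspaceT (is_derive1_continuous dH)).
rewrite in_itv/= => /andP[e0 ec] HE.
have -> : F 1 - F 0 - F1 0 - 2^-1 * F2 0 = (F2 e - F2 0) * c.
  move: GE HE; rewrite /G /H; lra.
rewrite normrM (ger0_norm c0) -[leRHS]mulr1 ler_pM//.
by rewrite F2B// e0 (le_trans ec).
Qed.

End taylor.

Section weak_taylor.
Context {R : realType} {d : nat}.
Local Notation rV := 'rV[R]_d.
Local Notation leb := (lebesgue_rV d).
Variables (f : rV -> R) (D2f : rV -> 'M[R]_d).
Hypothesis f1 : int1 leb f.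
Hypothesis f_hess : weak_hessian f D2f.
Hypothesis D2f_sq : forall i j, sqint leb (fun x => D2f x i j).

Lemma int1_mul_shift (k phi : rV -> R) v : int1 leb k ->
  measurable_fun [set: rV] phi -> (exists C, forall x, `|phi x| <= C) ->
  int1 leb (fun x => k x * phi (x + v)).
Proof.
move=> k1 mp [C pC]; apply: (int1_bounded (C := C)) => //.
rewrite addv_affine; apply: measurableT_comp => //; exact: measurable_affine.
Qed.

(** Differentiation under the integral sign: the derivatives of the product are
    bounded, so that a multiple of |f| dominates. *)
Lemma is_derive_int_prodf (g : 'I_d -> R -> R) (v : rV) (t : R) :
  (forall j, Cbinf (g j)) ->
  is_derive t 1 (fun t => \int[leb]_x (f x * prodf g (x + t *: v)))
    (\sum_i v ord0 i * \int[leb]_x (f x * prodf (der_at i g) (x + t *: v))).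
Proof.
move=> Cg.
have Cd i := Cbinf_der_at i Cg.
have /choice[C gC] : forall i, exists C, forall x, `|prodf (der_at i g) x| <= C.
  by move=> i; apply: prodf_bounded; exact: Cd.
pose S := \sum_i `|v ord0 i| * C i.
pose u (s : R) (x : rV) := f x * prodf g (x + s *: v).
have du (s : R) (x : rV) : is_derive s 1 (u ^~ x)
    (f x * \sum_i v ord0 i * prodf (der_at i g) (x + s *: v)).
  by apply: is_derive1Z; exact: is_derive_prodf.
have partE (s : R) (x : rV) : partial1of2 u s x =
    f x * \sum_i v ord0 i * prodf (der_at i g) (x + s *: v).
  by rewrite partial1of2E; case: (du s x).
have inti (s : R) h : (forall j, Cbinf (h j)) -> int1 leb (fun x => f x * prodf h (x + s *: v)).
  move=> Ch; apply: int1_mul_shift => //; first exact: prodf_measurable.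
  exact: prodf_bounded.
have t01 : `]t - 1, t + 1[%classic t.
  by rewrite /= in_itv/= ltrBlDr ltrDl ltr01.
have intu (s : R) : `]t - 1, t + 1[%classic s -> int1 leb (u s).
  by move=> _; exact: inti.
have deru (s : R) (x : rV) : `]t - 1, t + 1[%classic s -> setT x -> derivable (u ^~ x) s 1.
  by move=> _ _; case: (du s x).
have intG : int1 leb (fun x => `|f x| * S) by apply: int1Zr; exact: int1_norm.
have S0 : 0 <= S.
  by apply: sumr_ge0 => i _; rewrite mulr_ge0// (le_trans _ (gC i 0)).
have G0 (x : rV) : 0 <= `|f x| * S by exact: mulr_ge0.
have ubG (s : R) (x : rV) : `]t - 1, t + 1[%classic s -> setT x ->
    `|partial1of2 u s x| <= `|f x| * S.
  move=> _ _; rewrite partE normrM ler_wpM2l//.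
  rewrite (le_trans (ler_norm_sum _ _ _))//; apply: ler_sum => i _.
  by rewrite normrM ler_wpM2l.
have D := derivable_under_integral measurableT t01 intu deru G0 intG ubG.
have E := differentiation_under_integral measurableT t01 intu deru G0 intG ubG.
split; first exact: D.
rewrite -derive1E [LHS]E.
transitivity (\int[leb]_x \sum_i v ord0 i * (f x * prodf (der_at i g) (x + t *: v))).
  apply: eq_Rintegral => x _; rewrite partE mulr_sumr.
  by apply: eq_bigr => i _; rewrite mulrCA.
rewrite Rintegral_sum => [|i]; last by apply: int1Z; exact: inti.
by apply: eq_bigr => i _; rewrite RintegralZl//; exact: inti.
Qed.

(** All derivatives fall on the bump; the weak Hessian is only met when the
    second derivative is taken. *)
Lemma bump_span_taylor phi : bump_span phi -> exists c : 'I_d -> R, forall v : rV,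
  exists F1 : R -> R,
  [/\ forall t : R,
        is_derive t 1 (fun t => \int[leb]_x (f x * phi (x + t *: v))) (F1 t),
      F1 0 = \sum_i v ord0 i * c i &
      forall t : R, is_derive t 1 F1
        (\sum_i \sum_j v ord0 i * v ord0 j *
           \int[leb]_x (D2f x j i * phi (x + t *: v)))].
Proof.
elim=> [g a b sg|k p q sp [c Hp] sq [e Hq]].
  have Cg := sg.1.
  exists (fun i => \int[leb]_x (f x * prodf (der_at i g) x)) => v.
  exists (fun t => \sum_i v ord0 i *
    \int[leb]_x (f x * prodf (der_at i g) (x + t *: v))); split.
  - by move=> t; exact: is_derive_int_prodf.
  - by apply: eq_bigr => i _; under eq_Rintegral do rewrite scale0r addr0.
  - move=> t; have dd i := is_derive1Z (v ord0 i)
      (is_derive_int_prodf v t (Cbinf_der_at i Cg)).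
    have E i j : \int[leb]_x (f x * prodf (der_at j (der_at i g)) (x + t *: v)) =
        \int[leb]_x (D2f x j i * prodf g (x + t *: v)).
      have := f_hess j i (prodf_test_function (supported_shift (t *: v) sg)).
      under eq_Rintegral do rewrite partial2_shift//.
      by under [in X in _ = X -> _]eq_Rintegral do rewrite prodf_shift.
    apply: (is_derive_eq (is_derive1_sum (index_enum 'I_d) dd)).
    apply: eq_bigr => i _; rewrite mulr_sumr; apply: eq_bigr => j _.
    by rewrite mulrA E.
exists (fun i => c i + k * e i) => v.
have [Fp [dFp Fp0 ddFp]] := Hp v; have [Fq [dFq Fq0 ddFq]] := Hq v.
have bp := bump_span_bounded sp; have bq := bump_span_bounded sq.
have mp := int1_measurable (bump_span_int1 sp).
have mq := int1_measurable (bump_span_int1 sq).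
exists (fun t => Fp t + k * Fq t); split.
- move=> t; have := is_derive1D (dFp t) (is_derive1Z k (dFq t)).
  congr (is_derive _ _ _ _); apply/funext => s.
  rewrite -RintegralZl//; last exact: int1_mul_shift.
  rewrite -RintegralD//; [|exact: int1_mul_shift|].
    by apply: eq_Rintegral => x _; ring.
  by apply: int1Z; exact: int1_mul_shift.
- rewrite Fp0 Fq0 mulr_sumr -big_split/=; apply: eq_bigr => i _; ring.
- move=> t; apply: (is_derive_eq (is_derive1D (ddFp t) (is_derive1Z k (ddFq t)))).
  rewrite mulr_sumr -big_split/=; apply: eq_bigr => i _.
  rewrite mulr_sumr -big_split/=; apply: eq_bigr => j _.
  rewrite mulrCA -mulrDr; congr (_ * _).
  have sp' := sqint_shift (t *: v) (bump_span_sqint sp).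
  have sq' := sqint_shift (t *: v) (bump_span_sqint sq).
  rewrite -RintegralZl//; last exact: (sqintM (D2f_sq j i)).
  rewrite -RintegralD//; [|exact: (sqintM (D2f_sq j i))|].
    by apply: eq_Rintegral => x _; ring.
  by apply: int1Z; exact: (sqintM (D2f_sq j i)).
Qed.

Definition l1norm (v : rV) : R := \sum_i `|v ord0 i|.

Lemma l1norm_ge0 v : 0 <= l1norm v. Proof. exact: sumr_ge0. Qed.

Lemma l1normZ (a : R) v : l1norm (a *: v) = `|a| * l1norm v.
Proof. by rewrite /l1norm mulr_sumr; apply: eq_bigr => i _; rewrite mxE normrM. Qed.

(** By a translation the difference is the pairing of phi with an increment of
    the second derivative, whose norm is small for small v and at most twice
    the norm of the derivative in general.  A majorant with two values is used
    in place of the modulus of continuity, which would have to be shown to be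
    measurable. *)
Lemma hessian_modulus (e : R) : 0 < e -> exists delta M : R, [/\ 0 < delta, 0 <= M &
  forall phi, sqint leb phi -> forall v (t : R), 0 <= t <= 1 -> forall i j,
  `|\int[leb]_x (D2f x i j * phi (x + t *: v)) -
    \int[leb]_x (D2f x i j * phi (x + 0 *: v))| <=
  (e + M * (delta < l1norm v)%R%:R) * nrm2 leb phi].
Proof.
move=> e0; have e20 : 0 < e ^+ 2 by rewrite exprn_gt0.
have /choice[dl Hdl] : forall p : 'I_d * 'I_d, exists dl : R, 0 < dl /\
    forall v, l1norm v <= dl ->
    \int[leb]_x ((D2f (x + v) p.1 p.2 - D2f x p.1 p.2) ^+ 2) <= e ^+ 2.
  move=> p; have [dl dl0 H] := L2_translation_continuity (D2f_sq p.1 p.2) e20.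
  by exists dl; split.
pose delta := \big[Num.min/1]_(p : 'I_d * 'I_d) dl p.
pose M := \sum_(p : 'I_d * 'I_d) (2 * nrm2 leb (fun x => D2f x p.1 p.2)).
have M0 : 0 <= M by apply: sumr_ge0 => p _; rewrite mulr_ge0// nrm2_ge0.
exists delta, M; split => //.
  rewrite /delta; elim/big_ind: _ => //; first by move=> x y x0 y0; rewrite lt_min x0.
  by move=> p _; case: (Hdl p).
move=> phi sphi v t /andP[t0 t1] i j.
pose g x := D2f x i j; have sg : sqint leb g := D2f_sq i j.
have sgt := sqint_shift (- (t *: v)) sg.
have sd := sqintB sgt sg.
have E : \int[leb]_x (D2f x i j * phi (x + t *: v)) =
    \int[leb]_x (g (x - t *: v) * phi x).
  rewrite -(Rintegral_shift (t *: v) (sqintM sgt sphi)).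
  by apply: eq_Rintegral => x _; rewrite addrK.
have -> : \int[leb]_x (D2f x i j * phi (x + t *: v)) -
    \int[leb]_x (D2f x i j * phi (x + 0 *: v)) =
    \int[leb]_x ((g (x - t *: v) - g x) * phi x).
  rewrite E; under [X in _ - X]eq_Rintegral do rewrite scale0r addr0.
  rewrite -RintegralB//; [|exact: sqintM|exact: (sqintM sg)].
  by apply: eq_Rintegral => x _; rewrite mulrBl.
apply: (le_trans (cauchy_schwarz_nrm2 sd sphi)).
rewrite ler_wpM2r ?nrm2_ge0//.
have l1t : l1norm (- (t *: v)) <= l1norm v.
  by rewrite -scaleNr l1normZ normrN ger0_norm// ler_piMl// l1norm_ge0.
have [dv|vd] := ltP delta (l1norm v); last first.
  rewrite mulr0 addr0 -(@ler_pXn2r _ 2)// ?nnegrE ?nrm2_ge0 ?(ltW e0)// nrm2_sqr.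
  have [_ H] := Hdl (i, j); apply: H; rewrite (le_trans l1t)// (le_trans vd)//.
  by rewrite /delta (bigD1 (i, j))//= ge_min lexx.
rewrite mulr1 (@le_trans _ _ M)//; last by rewrite lerDr ltW.
rewrite (@le_trans _ _ (2 * nrm2 leb g))//; last first.
  by rewrite /M (bigD1 (i, j))//= lerDl; apply: sumr_ge0 => p _;
    rewrite mulr_ge0// nrm2_ge0.
rewrite -(@ler_pXn2r _ 2)// ?nnegrE ?nrm2_ge0 ?mulr_ge0 ?nrm2_ge0//.
rewrite exprMn !nrm2_sqr.
have := Rintegral_sqrD_le sgt (sqintZ (-1) sg).
under eq_Rintegral do rewrite mulN1r.
under [X in _ <= _ + 2 * X -> _]eq_Rintegral do rewrite exprMn sqrrN expr1n mul1r.
have [_ igg] := sg; rewrite (Rintegral_shift (- (t *: v)) igg) => /le_trans; apply.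
by rewrite le_eqVlt; apply/orP; left; apply/eqP; ring.
Qed.

(** The order of the quantifiers matters: delta and M serve all phi at once, as
    the duality argument requires, and c, the gradient of the pairing at v = 0,
    serves all v, so that it disappears on averaging over a kernel of mean
    zero. *)
Lemma bump_span_remainder (e : R) : 0 < e -> exists delta M : R, [/\ 0 < delta, 0 <= M &
  forall phi, bump_span phi -> exists c : 'I_d -> R, forall v,
  `|\int[leb]_x (f x * phi (x + v)) - \int[leb]_x (f x * phi x)
    - \sum_i v ord0 i * c i
    - 2^-1 * \sum_i \sum_j v ord0 i * v ord0 j * \int[leb]_x (D2f x j i * phi x)|
  <= l1norm v ^+ 2 * ((e + M * (delta < l1norm v)%R%:R) * nrm2 leb phi)].
Proof.
move=> e0; have [delta [M [delta0 M0 H]]] := hessian_modulus e0.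
exists delta, M; split => // phi sphi.
have [c Hc] := bump_span_taylor sphi; exists c => v.
have [F1 [dF F10 dF1]] := Hc v.
pose F2 (t : R) := \sum_i \sum_j v ord0 i * v ord0 j *
           \int[leb]_x (D2f x j i * phi (x + t *: v)).
pose B := l1norm v ^+ 2 * ((e + M * (delta < l1norm v)%R%:R) * nrm2 leb phi).
have := @taylor2 _ _ F1 F2 B dF dF1.
have E0 (k : rV -> R) : \int[leb]_x (k x * phi (x + 0 *: v)) =
    \int[leb]_x (k x * phi x).
  by apply: eq_Rintegral => x _; rewrite scale0r addr0.
have E1 : \int[leb]_x (f x * phi (x + 1 *: v)) =
    \int[leb]_x (f x * phi (x + v)).
  by apply: eq_Rintegral => x _; rewrite scale1r.
rewrite F10 E1 E0 /F2.
have -> : \sum_i \sum_j v ord0 i * v ord0 j *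
    \int[leb]_x (D2f x j i * phi (x + 0 *: v)) = \sum_i \sum_j v ord0 i * v ord0 j *
    \int[leb]_x (D2f x j i * phi x).
  by apply: eq_bigr => i _; apply: eq_bigr => j _; rewrite (E0 (fun x => D2f x j i)).
apply=> t t01; rewrite -sumrB (le_trans (ler_norm_sum _ _ _))//.
rewrite /B expr2 -mulrA {1}/l1norm mulr_suml; apply: ler_sum => i _.
rewrite -sumrB (le_trans (ler_norm_sum _ _ _))//.
rewrite {1}/l1norm mulr_suml mulr_sumr; apply: ler_sum => j _.
have := H _ (bump_span_sqint sphi) v t t01 j i.
rewrite (E0 (fun x => D2f x j i)).
by move=> Hij; rewrite -mulrBr 2!normrM -mulrA !ler_wpM2l.
Qed.

End weak_taylor.

(** * Convolution with a scaled kernel *)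

Lemma le_abse_fine {R : realType} (z : \bar R) : (`|(fine z)%:E| <= `|z|)%E.
Proof. by case: z => [r| |] /=; rewrite ?leey ?lexx. Qed.

Section real_fubini.
Context {d1 d2} {T1 : measurableType d1} {T2 : measurableType d2} {R : realType}.
Variables (m1 : {sigma_finite_measure set T1 -> \bar R})
          (m2 : {sigma_finite_measure set T2 -> \bar R}).
Implicit Type F : T1 * T2 -> R.

Definition int1_prod F := (m1 \x m2)%E.-integrable [set: T1 * T2] (EFin \o F).

Lemma Rintegral_ae_eq (f g : T1 -> R) : measurable_fun [set: T1] f ->
  measurable_fun [set: T1] g -> {ae m1, forall x, f x = g x} ->
  \int[m1]_x f x = \int[m1]_x g x.
Proof.
move=> mf mg fg; congr fine; apply: ae_eq_integral => //;
  [exact/measurable_EFinP|exact/measurable_EFinP|].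
by apply: filterS fg => x fgx _ /=; rewrite fgx.
Qed.

Lemma int1_prod_ae1 F : int1_prod F ->
  {ae m1, forall x, int1 m2 (fun y => F (x, y))}.
Proof. by move=> iF; exact: (ae_integrable1 iF). Qed.

Lemma fine_fubini1 F : int1_prod F ->
  measurable_fun [set: T1] (fun x => \int[m2]_y F (x, y)) /\
  {ae m1, forall x, (\int[m2]_y F (x, y))%:E = (\int[m2]_y (F (x, y))%:E)%E}.
Proof.
move=> iF; split.
  apply: measurableT_comp; first exact: fine_measurable.
  exact: (measurable_fubini_F iF).
apply: filterS (int1_prod_ae1 iF) => x Fx.
by rewrite int1_EFin.
Qed.

(** The inner integral may be infinite on a null set; reading it as a real number
    changes it there to 0, which only makes it smaller in absolute value. *)
Lemma int1_fubini1 F : int1_prod F ->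
  int1 m1 (fun x => \int[m2]_y F (x, y)).
Proof.
move=> iF; have [mF aeF] := fine_fubini1 iF.
have iG := integrable_fubini_F iF.
apply: le_integrable iG => //; first exact/measurable_EFinP.
by move=> x _; exact: le_abse_fine.
Qed.

Lemma Rfubini1 F : int1_prod F ->
  (\int[m1]_x \int[m2]_y F (x, y))%:E = (\int[m1 \x m2]_z (F z)%:E)%E.
Proof.
move=> iF; have [mF aeF] := fine_fubini1 iF.
rewrite -int1_EFin; last exact: int1_fubini1.
rewrite -(integral12_prod_meas1 iF); apply: ae_eq_integral => //.
- exact/measurable_EFinP.
- exact: (measurable_fubini_F iF).
- by apply: filterS aeF => x Fx _.
Qed.

End real_fubini.

Section real_fubini2.
Context {d1 d2} {T1 : measurableType d1} {T2 : measurableType d2} {R : realType}.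
Variables (m1 : {sigma_finite_measure set T1 -> \bar R})
          (m2 : {sigma_finite_measure set T2 -> \bar R}).
Implicit Type F : T1 * T2 -> R.

Lemma fine_fubini2 F : int1_prod m1 m2 F ->
  measurable_fun [set: T2] (fun y => \int[m1]_x F (x, y)) /\
  {ae m2, forall y, (\int[m1]_x F (x, y))%:E = (\int[m1]_x (F (x, y))%:E)%E}.
Proof.
move=> iF; split.
  apply: measurableT_comp; first exact: fine_measurable.
  exact: (measurable_fubini_G iF).
have H := ae_integrable2 iF.
by apply: filterS H => x Fx; rewrite int1_EFin.
Qed.

Lemma int1_fubini2 F : int1_prod m1 m2 F ->
  int1 m2 (fun y => \int[m1]_x F (x, y)).
Proof.
move=> iF; have [mF _] := fine_fubini2 iF.
have mE := measurable_int _ iF.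
apply/integrableP; split; first exact/measurable_EFinP.
apply: le_lt_trans ((integrable21ltyP m1 m2 mE).1 iF).
apply: ge0_le_integral => //.
- by apply: measurableT_comp => //; exact/measurable_EFinP.
- have n0 z : (0 <= (abse \o (EFin \o F)) z)%E by exact: abse_ge0.
  apply: (measurable_fun_fubini_tonelli_G (abse \o (EFin \o F)) _ n0).
  exact: measurableT_comp.
- move=> y _; apply: (@le_trans _ _ `|\int[m1]_x (F (x, y))%:E|%E).
    exact: le_abse_fine.
  by apply: le_abse_integral => //; exact: (measurableT_comp mE (pair2_measurable y)).
Qed.

(** Both iterated integrals equal the integral over the product, since the real
    and the extended inner integrals agree almost everywhere. *)
Lemma Rfubini F : int1_prod m1 m2 F ->
  \int[m1]_x \int[m2]_y F (x, y) = \int[m2]_y \int[m1]_x F (x, y).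
Proof.
move=> iF; apply: EFin_inj; rewrite Rfubini1// -(integral21_prod_meas1 iF).
have [mF aeF] := fine_fubini2 iF.
rewrite -int1_EFin; last exact: int1_fubini2.
apply/esym; apply: ae_eq_integral => //.
- exact/measurable_EFinP.
- exact: (measurable_fubini_G iF).
- by apply: filterS aeF => x Fx _.
Qed.

End real_fubini2.

Section convolution.
Context {R : realType} {d : nat}.
Local Notation rV := 'rV[R]_d.
Local Notation leb := (lebesgue_rV d).
Variables (K f : rV -> R).
Hypothesis K1 : int1 leb K.
Hypothesis f1 : int1 leb f.
Hypothesis f2 : sqint leb f.

(** The mean of the kernel estimator, after the substitution y = x - h u. *)
Definition kconv (h : R) (x : rV) : R := \int[leb]_u (K u * f (x - h *: u)).

Lemma measurable_sub_scale (a : R) :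
  measurable_fun [set: rV * rV] (fun p : rV * rV => p.1 - a *: p.2 : rV).
Proof.
apply/measurable_fun_rVP => i; under eq_fun do rewrite !mxE.
apply: measurable_funB.
  exact: (measurableT_comp (measurable_coord i) measurable_fst).
apply: measurable_funM => //.
exact: (measurableT_comp (measurable_coord i) measurable_snd).
Qed.

(** Integrating over x first, translation invariance makes the inner integral
    independent of u. *)
Lemma int1_prod_conv (k g : rV -> R) (h : R) : int1 leb k -> int1 leb g ->
  int1_prod leb leb (fun p => k p.2 * g (p.1 - h *: p.2)).
Proof.
move=> k1 g1; apply/integrable21ltyP.
  apply/measurable_EFinP; apply: measurable_funM.
    exact: (measurableT_comp (int1_measurable k1) measurable_snd).
  exact: (measurableT_comp (int1_measurable g1) (measurable_sub_scale h)).
have E (u : rV) : (\int[leb]_x `|(k u * g (x - h *: u))%:E| =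
    (`|k u| * \int[leb]_x `|g x|)%:E)%E.
  under eq_integral do rewrite abse_EFin.
  have ig := int1_norm g1.
  rewrite int1_EFin; last first.
    under eq_fun do rewrite normrM; apply: int1Z.
    exact: (int1_shift (- (h *: u)) ig).
  under eq_Rintegral do rewrite normrM.
  rewrite RintegralZl//; last exact: (int1_shift (- (h *: u)) ig).
  by rewrite (Rintegral_shift (- (h *: u)) ig).
under eq_integral do rewrite E.
by rewrite int1_EFin ?ltry//; apply: int1Zr; exact: int1_norm.
Qed.

Lemma kconv_int1 h : int1 leb (kconv h).
Proof. exact: (int1_fubini1 (int1_prod_conv h K1 f1)). Qed.

(** Fubini, followed by the translation x := x + h u. *)
Lemma kconv_adjoint h (phi : rV -> R) : measurable_fun [set: rV] phi ->
  (exists C, forall x, `|phi x| <= C) ->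
  int1 leb (fun u => K u * \int[leb]_x (f x * phi (x + h *: u))) /\
  \int[leb]_x (kconv h x * phi x) =
  \int[leb]_u (K u * \int[leb]_x (f x * phi (x + h *: u))).
Proof.
move=> mp [C pC].
pose F (p : rV * rV) := K p.2 * f (p.1 - h *: p.2) * phi p.1.
have iF0 := int1_prod_conv h K1 f1.
have iF : int1_prod leb leb F.
  apply: (@int1_bounded _ _ _ (leb \x leb)%E _ (fun p => phi p.1) C _ iF0) => //.
  exact: (measurableT_comp mp measurable_fst).
have FE u : \int[leb]_x F (x, u) = K u * \int[leb]_x (f x * phi (x + h *: u)).
  have ifp : int1 leb (fun x => f x * phi (x + h *: u)).
    by apply: int1_mul_shift => //; exists C.
  rewrite -(Rintegral_shift (- (h *: u)) ifp) -RintegralZl//; last first.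
    exact: (int1_shift (- (h *: u)) ifp).
  by apply: eq_Rintegral => x _; rewrite /F /= subrK mulrA.
have iF2 := int1_fubini2 iF.
split; first by under eq_fun do rewrite -FE.
under [RHS]eq_Rintegral do rewrite -FE.
rewrite -(Rfubini iF); apply: Rintegral_ae_eq.
- by apply: measurable_funM => //; exact: int1_measurable (kconv_int1 h).
- exact: int1_measurable (int1_fubini1 iF).
- apply: filterS (int1_prod_ae1 iF0) => x Fx.
  by rewrite /F /= RintegralZr.
Qed.

(** Young's inequality for the exponents 1, 2, 2: Cauchy-Schwarz for the weight
    |K| bounds the square of the convolution by |K|_1 times the convolution of
    |K| and f^2, for almost every x. *)
Lemma kconv_young h : sqint leb (kconv h) /\
  \int[leb]_x (kconv h x ^+ 2) <= (\int[leb]_u `|K u|) ^+ 2 * \int[leb]_x (f x ^+ 2).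
Proof.
have [mf ff] := f2.
have Kn := int1_norm K1.
pose k1 := \int[leb]_u `|K u|.
have k10 : 0 <= k1 by exact: Rintegral_ge0.
pose G (p : rV * rV) := `|K p.2| * f (p.1 - h *: p.2) ^+ 2.
have iG : int1_prod leb leb G.
  exact: (int1_prod_conv h Kn ff).
have mk := int1_measurable (kconv_int1 h).
have aeG : {ae leb, forall x, setT x -> ((kconv h x ^+ 2)%:E <=
    (k1 * \int[leb]_u G (x, u))%:E)%E}.
  apply: filterS (int1_prod_ae1 iG) => x Gx _; rewrite lee_fin.
  have mfx : measurable_fun [set: rV] (fun u => f (x - h *: u)).
    apply: measurableT_comp => //.
    exact: (measurableT_comp (measurable_sub_scale h) (pair1_measurable x)).
  have mK := int1_measurable Kn.
  have msK : measurable_fun [set: rV] (fun u => Num.sqrt `|K u|).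
    exact: (measurableT_comp (continuous_measurable_fun (@sqrt_continuous R)) mK).
  have sa : sqint leb (fun u => Num.sqrt `|K u|).
    by split => //; under eq_fun do rewrite sqr_sqrtr//.
  have sb : sqint leb (fun u => Num.sqrt `|K u| * `|f (x - h *: u)|).
    split.
      by apply: measurable_funM => //; exact: measurableT_comp.
    by under eq_fun do rewrite exprMn sqr_sqrtr// real_normK ?num_real//.
  have := cauchy_schwarz sa sb.
  under [X in _ <= X * _ -> _]eq_Rintegral do rewrite sqr_sqrtr//.
  under [X in _ <= _ * X -> _]eq_Rintegral do
    rewrite exprMn sqr_sqrtr// real_normK ?num_real//.
  apply: le_trans.
  rewrite -[leLHS]real_normK ?num_real// lerXn2r ?nnegrE//.
    by apply: Rintegral_ge0 => u _; rewrite !mulr_ge0// sqrtr_ge0.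
  have sab := sqintM sa sb.
  apply: le_norm_Rintegral => //.
    apply: (int1_le _ sab); first exact: measurable_funM (int1_measurable K1) mfx.
    by move=> u; rewrite mulrA -expr2 sqr_sqrtr// normrM normrM !normr_id.
  by move=> u; rewrite mulrA -expr2 sqr_sqrtr// normrM.
have iH : int1 leb (fun x => k1 * \int[leb]_u G (x, u)).
  by apply: int1Z; exact: int1_fubini1.
have le1 : (\int[leb]_x (kconv h x ^+ 2)%:E <=
    \int[leb]_x (k1 * \int[leb]_u G (x, u))%:E)%E.
  apply: ae_ge0_le_integral => //.
  - by move=> x _; rewrite lee_fin sqr_ge0.
  - by apply/measurable_EFinP; exact: measurable_funX.
  - move=> x _; rewrite lee_fin mulr_ge0//; apply: Rintegral_ge0 => u _.
    by rewrite /G mulr_ge0// sqr_ge0.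
  - by apply/measurable_EFinP; exact: int1_measurable iH.
have sk : sqint leb (kconv h).
  split => //; apply: int1_ge0P; first exact: measurable_funX.
    by move=> x; exact: sqr_ge0.
  by apply: (le_lt_trans le1); rewrite int1_EFin// ltry.
split => //.
move: le1; rewrite int1_EFin; last by case: sk.
rewrite int1_EFin// lee_fin => /le_trans; apply.
rewrite RintegralZl//; last exact: int1_fubini1.
rewrite (Rfubini iG) expr2 -mulrA ler_wpM2l//.
rewrite /G /= le_eqVlt; apply/orP; left; apply/eqP.
rewrite mulrC /k1 -RintegralZl//; apply: eq_Rintegral => u _.
have H := Rintegral_shift (- (h *: u)) ff.
rewrite RintegralZl//; last exact: (int1_shift (- (h *: u)) ff).
by rewrite H mulrC.
Qed.

End convolution.

Section duality.
Context {R : realType} {d : nat}.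
Local Notation rV := 'rV[R]_d.
Local Notation leb := (lebesgue_rV d).

Lemma nrm2D (f g : rV -> R) : sqint leb f -> sqint leb g ->
  nrm2 leb (fun x => f x + g x) <= nrm2 leb f + nrm2 leb g.
Proof.
move=> sf sg; rewrite -(@ler_pXn2r _ 2)// ?nnegrE ?addr_ge0 ?nrm2_ge0//.
have := RintegralDsq 1 sf sg.
under [X in X = _ -> _]eq_Rintegral do rewrite mul1r.
rewrite nrm2_sqr => ->; rewrite -!nrm2_sqr.
have := cauchy_schwarz_nrm2 sf sg; have := ler_norm (\int[leb]_x (f x * g x)).
lra.
Qed.

(** Testing against phi close to q gives, in the limit, |q|^2 <= C |q|. *)
Lemma nrm2_duality (q : rV -> R) C : sqint leb q -> 0 <= C ->
  (forall phi, bump_span phi -> `|\int[leb]_x (q x * phi x)| <= C * nrm2 leb phi) ->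
  nrm2 leb q <= C.
Proof.
move=> sq C0 qC; rewrite leNgt; apply/negP => CN.
set N := nrm2 leb q in CN.
have N0 : 0 < N by exact: le_lt_trans CN.
(* with this e the error e (N + C) is half of the gap N^2 - C N *)
pose e := N * (N - C) / (2 * (N + C)).
have NC : 0 < 2 * (N + C) by lra.
have e0 : 0 < e by rewrite divr_gt0// mulr_gt0// subr_gt0.
have [phi sphi] := bump_span_dense sq (exprn_gt0 2 e0).
have sp := bump_span_sqint sphi; have sqp := sqintB sq sp.
rewrite -nrm2_sqr ler_pXn2r ?nnegrE ?nrm2_ge0 ?(ltW e0)// => qpe.
have pN : nrm2 leb phi <= N + e.
  have := nrm2D sq (sqintZ (-1) sqp).
  have -> : (fun x => q x + -1 * (q x - phi x)) = phi by apply/funext => x; ring.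
  have -> : nrm2 leb (fun x => -1 * (q x - phi x)) = nrm2 leb (fun x => q x - phi x).
    rewrite /nrm2; congr Num.sqrt; apply: eq_Rintegral => x _.
    by rewrite exprMn sqrrN expr1n mul1r.
  rewrite -/N; move: qpe; lra.
have E : N ^+ 2 = \int[leb]_x (q x * (q x - phi x)) + \int[leb]_x (q x * phi x).
  rewrite /N nrm2_sqr -RintegralD//; [|exact: sqintM sq sqp|exact: sqintM sq sp].
  by apply: eq_Rintegral => x _; ring.
have H1 : \int[leb]_x (q x * (q x - phi x)) <= N * e.
  apply: (le_trans (ler_norm _)); apply: (le_trans (cauchy_schwarz_nrm2 sq sqp)).
  by rewrite ler_wpM2l// nrm2_ge0.
have H2 : \int[leb]_x (q x * phi x) <= C * (N + e).
  apply: (le_trans (ler_norm _)); apply: (le_trans (qC _ sphi)).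
  by rewrite ler_wpM2l.
have eE : e * (N + C) = N * (N - C) / 2.
  by rewrite /e; field; rewrite gt_eqF//; lra.
have : N * (N - C) <= N * (N - C) / 2 by rewrite -eE; move: E H1 H2; nra.
have : 0 < N * (N - C) by rewrite mulr_gt0// subr_gt0.
lra.
Qed.

End duality.

(** * The bias *)

Section bias.
Context {R : realType} {d : nat}.
Local Notation rV := 'rV[R]_d.
Local Notation leb := (lebesgue_rV d).
Variables (K f : rV -> R) (D2f : rV -> 'M[R]_d).
Hypothesis K1 : int1 leb K.
Hypothesis K_int1 : \int[leb]_u K u = 1.
Hypothesis K_mean0 : forall i, \int[leb]_u (u ord0 i * K u) = 0.
Hypothesis K_moment2 : int1 leb (fun u => enorm u ^+ 2 * `|K u|).
Hypothesis f1 : int1 leb f.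
Hypothesis f2 : sqint leb f.
Hypothesis f_hess : weak_hessian f D2f.
Hypothesis D2f_sq : forall i j, sqint leb (fun x => D2f x i j).

(** The sum of the absolute values of the coordinates is easier to combine with
    double sums than the Euclidean norm; the two are comparable. *)
Lemma coord_le_enorm (u : rV) i : `|u ord0 i| <= enorm u.
Proof.
rewrite -sqrtr_sqr ler_wsqrtr// (bigD1 i)//= lerDl.
by apply: sumr_ge0 => j _; exact: sqr_ge0.
Qed.

Lemma l1norm_le_enorm (u : rV) : l1norm u <= d%:R * enorm u.
Proof.
rewrite /l1norm (le_trans (ler_sum _ (fun i _ => coord_le_enorm u i)))//.
by rewrite sumr_const card_ord mulr_natl.
Qed.

Let measurable_coordE i : measurable_fun [set: rV] (fun u : rV => u ord0 i).
Proof. exact: measurable_coord. Qed.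

Lemma measurable_l1norm : measurable_fun [set: rV] l1norm.
Proof.
by apply: measurable_sum => i; exact: measurableT_comp.
Qed.

Let mK := int1_measurable K1.

Lemma int1_l1norm_sqr : int1 leb (fun u => `|K u| * l1norm u ^+ 2).
Proof.
apply: (@int1_le _ _ _ _ _ (fun u => d%:R ^+ 2 * (enorm u ^+ 2 * `|K u|))).
- apply: measurable_funM; first exact: measurableT_comp.
  by apply: measurable_funX; exact: measurable_l1norm.
- exact: int1Z.
- move=> u.
  rewrite (ger0_norm (mulr_ge0 (normr_ge0 _) (sqr_ge0 _))).
  rewrite (ger0_norm (mulr_ge0 (sqr_ge0 _) (mulr_ge0 (sqr_ge0 _) (normr_ge0 _)))).
  rewrite mulrC mulrA ler_wpM2r// -exprMn lerXn2r ?nnegrE ?l1norm_ge0 ?l1norm_le_enorm//.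
  by rewrite mulr_ge0// sqrtr_ge0.
Qed.

Lemma coord_le_l1norm (u : rV) i : `|u ord0 i| <= l1norm u.
Proof. by rewrite /l1norm (bigD1 i)//= lerDl; exact: sumr_ge0. Qed.

(** |u_i| <= 1 + |u|^2 makes the first moments finite. *)
Lemma int1_coord i : int1 leb (fun u => u ord0 i * K u).
Proof.
apply: (@int1_le _ _ _ _ _ (fun u => `|K u| + `|K u| * l1norm u ^+ 2)).
- exact: measurable_funM.
- by apply: int1D; [exact: int1_norm|exact: int1_l1norm_sqr].
- move=> u; rewrite normrM [leRHS]ger0_norm; last first.
    by rewrite addr_ge0// mulr_ge0// sqr_ge0.
  rewrite mulrC -[X in _ <= X + _]mulr1 -mulrDr ler_wpM2l//.
  have := coord_le_l1norm u i; have := l1norm_ge0 u; have := sqr_ge0 (l1norm u - 1).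
  by rewrite sqrrB1; lra.
Qed.

Lemma int1_coord2 i j : int1 leb (fun u => u ord0 i * u ord0 j * K u).
Proof.
apply: (int1_le _ int1_l1norm_sqr).
- by apply: measurable_funM => //; exact: measurable_funM.
- move=> u.
  rewrite (ger0_norm (mulr_ge0 (normr_ge0 _) (sqr_ge0 _))).
  by rewrite !normrM mulrC ler_wpM2l// expr2 ler_pM// coord_le_l1norm.
Qed.

Lemma LK_E x : LK K D2f x = \sum_i \sum_j second_moment K i j * D2f x j i.
Proof. by rewrite /LK /mxtrace; apply: eq_bigr => i _; rewrite mxE. Qed.

Lemma sqint_LK : sqint leb (LK K D2f).
Proof.
rewrite (_ : LK K D2f = fun x => \sum_i \sum_j second_moment K i j * D2f x j i).
  by apply: sqint_sum => i; apply: sqint_sum => j; exact: sqintZ.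
by apply/funext => x; rewrite LK_E.
Qed.

Definition bias_error (h : R) (x : rV) : R :=
  kconv K f h x - f x - h ^+ 2 / 2 * LK K D2f x.

Lemma sqint_bias_error h : sqint leb (bias_error h).
Proof.
have [sk _] := kconv_young K1 f1 f2 h.
by apply: sqintB; [exact: sqintB|apply: sqintZ; exact: sqint_LK].
Qed.

(** Tested against a bump, the bias error is the kernel average of the Taylor
    remainders: the moments of the kernel remove the first-order term and turn
    the second-order one into [LK]. *)
Lemma bias_error_duality (h : R) (phi : rV -> R) (c : 'I_d -> R) : bump_span phi ->
  let rem (v : rV) := \int[leb]_x (f x * phi (x + v)) - \int[leb]_x (f x * phi x)
    - \sum_i v ord0 i * c i
    - 2^-1 * \sum_i \sum_j v ord0 i * v ord0 j * \int[leb]_x (D2f x j i * phi x) in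
  int1 leb (fun u => K u * rem (h *: u)) /\
  \int[leb]_x (bias_error h x * phi x) = \int[leb]_u (K u * rem (h *: u)).
Proof.
move=> sphi rem.
have bp := bump_span_bounded sphi; have sp := bump_span_sqint sphi.
have mp := int1_measurable (bump_span_int1 sphi).
have [iI adj] := kconv_adjoint K1 f1 h mp bp.
have [sk _] := kconv_young K1 f1 f2 h.
pose I0 := \int[leb]_x (f x * phi x).
pose J i j := \int[leb]_x (D2f x j i * phi x).
have i1 : int1 leb (fun u => I0 * K u) by exact: int1Z.
have i2 i : int1 leb (fun u => h * c i * (u ord0 i * K u)).
  by apply: int1Z; exact: int1_coord.
have i3 i j : int1 leb (fun u => h ^+ 2 / 2 * J i j * (u ord0 i * u ord0 j * K u)).
  by apply: int1Z; exact: int1_coord2.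
have i2s : int1 leb (fun u => \sum_i h * c i * (u ord0 i * K u)) by exact: int1_sum.
have i3s i : int1 leb (fun u => \sum_j h ^+ 2 / 2 * J i j * (u ord0 i * u ord0 j * K u)).
  exact: int1_sum.
have i3ss : int1 leb (fun u => \sum_i \sum_j h ^+ 2 / 2 * J i j *
    (u ord0 i * u ord0 j * K u)) by exact: int1_sum.
have remE u : K u * rem (h *: u) =
    K u * (\int[leb]_x (f x * phi (x + h *: u))) - I0 * K u
    - \sum_i h * c i * (u ord0 i * K u)
    - \sum_i \sum_j h ^+ 2 / 2 * J i j * (u ord0 i * u ord0 j * K u).
  rewrite /rem !mulrBr; congr (_ - _ - _ - _).
  - by rewrite mulrC.
  - by rewrite mulr_sumr; apply: eq_bigr => i _; rewrite mxE; ring.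
  - rewrite !mulr_sumr; apply: eq_bigr => i _.
    by rewrite !mulr_sumr; apply: eq_bigr => j _; rewrite !mxE /J; field.
have iL := int1B iI i1.
have iL2 := int1B iL i2s.
split; first by under eq_fun do rewrite remE; exact: int1B.
under [RHS]eq_Rintegral do rewrite remE.
rewrite RintegralB// RintegralB// RintegralB// -adj.
rewrite RintegralZl// K_int1 mulr1.
rewrite Rintegral_sum// [X in _ - _ - X - _]big1 ?subr0; last first.
  by move=> i _; rewrite RintegralZl ?K_mean0 ?mulr0//; exact: int1_coord.
rewrite Rintegral_sum//.
have -> : \sum_i \int[leb]_u (\sum_j h ^+ 2 / 2 * J i j * (u ord0 i * u ord0 j * K u))
    = \int[leb]_x (h ^+ 2 / 2 * LK K D2f x * phi x).
  have iD i j : int1 leb (fun x => h ^+ 2 / 2 * second_moment K i j * (D2f x j i * phi x)).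
    by apply: int1Z; exact: sqintM.
  transitivity (\sum_i \sum_j h ^+ 2 / 2 * second_moment K i j * J i j).
    apply: eq_bigr => i _; rewrite Rintegral_sum//; apply: eq_bigr => j _.
    by rewrite RintegralZl; [rewrite mxE mulrAC|by []|exact: int1_coord2].
  transitivity (\int[leb]_x \sum_i \sum_j h ^+ 2 / 2 * second_moment K i j *
      (D2f x j i * phi x)).
    rewrite Rintegral_sum => [|i]; last exact: int1_sum.
    apply: eq_bigr => i _; rewrite Rintegral_sum//; apply: eq_bigr => j _.
    by rewrite RintegralZl//; exact: sqintM.
  apply: eq_Rintegral => x _; rewrite LK_E mulr_sumr mulr_suml; apply: eq_bigr => i _.
  by rewrite mulr_sumr mulr_suml; apply: eq_bigr => j _; ring.
rewrite -RintegralB//; [|exact: sqintM|exact: sqintM].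
rewrite -RintegralB//; last first.
- by apply: sqintM => //; apply: sqintZ; exact: sqint_LK.
- by apply: int1B; exact: sqintM.
by apply: eq_Rintegral => x _; rewrite /bias_error; ring.
Qed.

Lemma bool_le1 (b : bool) : b%:R <= 1 :> R.
Proof. by case: b; rewrite ?ler01. Qed.

Lemma measurable_l1norm_tail (k : R) :
  measurable_fun [set: rV] (fun u => (k < l1norm u)%R%:R : R).
Proof.
have -> : (fun u => (k < l1norm u)%R%:R : R) =
    (\1_(l1norm @^-1` `]k, +oo[%classic) : rV -> R).
  apply/funext => u; rewrite indicE; congr (_%:R); congr nat_of_bool.
  by apply/idP/idP; rewrite inE/= in_itv/= andbT.
apply: measurable_indic; rewrite -[X in measurable X]setTI.
exact: measurable_l1norm.
Qed.

Lemma second_moment_tail (e : R) : 0 < e -> exists2 k : R, 0 < k &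
  \int[leb]_u (`|K u| * l1norm u ^+ 2 * (k < l1norm u)%R%:R) <= e.
Proof.
move=> e0.
have : \int[leb]_u (`|K u| * l1norm u ^+ 2 * (n.+1%:R < l1norm u)%R%:R) @[n --> \oo] --> (0 : R).
  apply: (int1_dominated_cvg0 _ int1_l1norm_sqr).
  - by move=> n; apply: measurable_funM;
      [exact: int1_measurable int1_l1norm_sqr|exact: measurable_l1norm_tail].
  - move=> n u; have A0 := mulr_ge0 (normr_ge0 (K u)) (sqr_ge0 (l1norm u)).
    by rewrite normrM (ger0_norm A0) ger0_norm// ler_piMr// bool_le1.
  - move=> u; apply: cvg_near_cst; near=> n.
    rewrite ltNge (_ : l1norm u <= n.+1%:R) ?mulr0//.
    apply: (@le_trans _ _ n%:R); last by rewrite ler_nat.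
    by near: n; exact: nbhs_infty_ger.
move=> /cvgrPdist_le /(_ e e0)[n _ /(_ n (leqnn n))].
rewrite sub0r normrN => H; exists n.+1%:R; first by rewrite ltr0n.
exact: le_trans (ler_norm _) H.
Unshelve. all: by end_near. Qed.

(** Small and large u are treated separately: where h |u| <= delta the modulus of
    continuity of the Hessian is small, and the rest is a tail of the second
    absolute moment of K. *)
Theorem bias_expansion (e : R) : 0 < e -> exists2 eta : R, 0 < eta &
  forall h, 0 < h -> h < eta -> nrm2 leb (bias_error h) <= e * h ^+ 2.
Proof.
move=> e0.
pose S2 := \int[leb]_u (`|K u| * l1norm u ^+ 2).
have S20 : 0 <= S2.
  by apply: Rintegral_ge0 => u _; rewrite mulr_ge0 ?sqr_ge0.
have e1 : 0 < e / 2 / (S2 + 1) by rewrite !divr_gt0// ltr_wpDl.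
have [delta [M [delta0 M0 H]]] := bump_span_remainder f1 f_hess D2f_sq e1.
have e2 : 0 < e / 2 / (M + 1) by rewrite !divr_gt0// ltr_wpDl.
have [k k0 Hk] := second_moment_tail e2.
(* for h < delta / k, the condition delta < h |u| forces k < |u| *)
exists (delta / k); first by rewrite divr_gt0.
move=> h h0 hk; apply: nrm2_duality.
- exact: sqint_bias_error.
- by rewrite mulr_ge0 ?sqr_ge0// ltW.
move=> phi sphi; have [c Hc] := H _ sphi.
have [iR ->] := bias_error_duality h c sphi.
set N := nrm2 leb phi in Hc *; have N0 : 0 <= N by exact: nrm2_ge0.
set e' := e / 2 / (S2 + 1) in e1 Hc.
have iT : int1 leb (fun u => `|K u| * l1norm u ^+ 2 * (k < l1norm u)%R%:R).
  apply: (int1_le _ int1_l1norm_sqr).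
    apply: measurable_funM; first exact: int1_measurable int1_l1norm_sqr.
    exact: measurable_l1norm_tail.
  by move=> u; rewrite [leLHS]normrM ler_piMr// ger0_norm// bool_le1.
have iB : int1 leb (fun u => h ^+ 2 * N * (e' * (`|K u| * l1norm u ^+ 2) +
    M * (`|K u| * l1norm u ^+ 2 * (k < l1norm u)%R%:R))).
  by apply: int1Z; apply: int1D; apply: int1Z => //; exact: int1_l1norm_sqr.
apply: (le_trans (le_norm_Rintegral iR iB _)).
  move=> u; rewrite normrM.
  apply: (@le_trans _ _ (`|K u| * (l1norm (h *: u) ^+ 2 *
      ((e' + M * (delta < l1norm (h *: u))%R%:R) * N)))); first by rewrite ler_wpM2l.
  rewrite l1normZ (gtr0_norm h0).
  have kh : (delta < h * l1norm u)%R%:R <= (k < l1norm u)%R%:R :> R.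
    rewrite ler_nat; have [dh|//] := ltP delta (h * l1norm u).
    have -> // : k < l1norm u.
    have n0 : 0 < l1norm u by rewrite -(pmulr_rgt0 _ h0) (lt_trans delta0).
    move: hk; rewrite ltr_pdivlMr// => hk.
    by rewrite -(ltr_pM2l h0) (lt_trans hk).
  rewrite [leRHS](_ : _ =
    `|K u| * ((h * l1norm u) ^+ 2 * ((e' + M * (k < l1norm u)%R%:R) * N))); last by ring.
  by rewrite ler_wpM2l// ler_wpM2l ?sqr_ge0// ler_wpM2r// lerD2l ler_wpM2l.
rewrite RintegralZl//; last first.
  by apply: int1D; apply: int1Z => //; exact: int1_l1norm_sqr.
rewrite RintegralD//; [|apply: int1Z; exact: int1_l1norm_sqr|exact: int1Z].
rewrite RintegralZl//; last exact: int1_l1norm_sqr.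
rewrite RintegralZl// -/S2.
have h20 : 0 <= h ^+ 2 by exact: sqr_ge0.
rewrite [leRHS](_ : _ = h ^+ 2 * N * e); last by ring.
rewrite ler_wpM2l ?(mulr_ge0 h20)//.
set T := Rintegral _ _ _ in Hk *.
have A1 : e' * S2 <= e / 2.
  by rewrite /e' mulrAC ler_pdivrMr ?ltr_wpDl// ler_wpM2l ?divr_ge0 ?(ltW e0)// lerDl.
have A2 : M * T <= e / 2.
  apply: (@le_trans _ _ (M * (e / 2 / (M + 1)))); first by rewrite ler_wpM2l.
  rewrite mulrC mulrAC ler_pdivrMr ?ltr_wpDl//.
  by rewrite ler_wpM2l ?divr_ge0 ?(ltW e0)// lerDl.
lra.
Qed.

End bias.

(** * The mean square error of a sample mean *)

Section density.
Context {disp} {T : measurableType disp} {R : realType}.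
Variables (mu : {sigma_finite_measure set T -> \bar R})
  (nu : {finite_measure set T -> \bar R}) (f : T -> R).
Hypothesis f_ge0 : forall x, 0 <= f x.
Hypothesis f1 : int1 mu f.
Hypothesis nuE : forall A, measurable A -> nu A = (\int[mu]_(x in A) (f x)%:E)%E.

(** f is the Radon-Nikodym derivative of nu, up to a null set. *)
Lemma ge0_integral_density (g : T -> \bar R) :
  measurable_fun [set: T] g -> (forall x, (0 <= g x)%E) ->
  (\int[nu]_x g x = \int[mu]_x (g x * (f x)%:E))%E.
Proof.
move=> mg g0.
have dom : nu `<< mu.
  apply/null_content_dominatesP => A mA A0; rewrite nuE//.
  apply: null_set_integral => //.
  by apply: measurable_funTS; exact: measurable_int f1.
pose r := Radon_Nikodym_SigmaFinite.f nu mu.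
have rf : ae_eq mu setT r (EFin \o f).
  apply: integral_ae_eq => //.
  - exact: Radon_Nikodym_SigmaFinite.f_integrable.
  - exact: measurable_int f1.
  - by move=> A _ mA; rewrite -Radon_Nikodym_SigmaFinite.f_integral// nuE.
rewrite -(Radon_Nikodym_SigmaFinite.change_of_variables dom g0 measurableT mg).
apply: ae_eq_integral => //.
- apply: emeasurable_funM => //.
  exact: measurable_int (Radon_Nikodym_SigmaFinite.f_integrable dom).
- by apply: emeasurable_funM => //; exact: measurable_int f1.
- by apply: filterS rf => x rfx xT; rewrite -/r rfx.
Qed.

Lemma int1_density (g : T -> R) : measurable_fun [set: T] g ->
  int1 mu (fun x => g x * f x) -> int1 nu g.
Proof.
move=> mg /integrableP[_ gf]; apply/integrableP; split; first exact/measurable_EFinP.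
rewrite ge0_integral_density//; last by apply: measurableT_comp => //; exact/measurable_EFinP.
apply: le_lt_trans gf; apply: ge0_le_integral => //.
- by move=> x _; rewrite mule_ge0// lee_fin.
- apply: emeasurable_funM; last exact: measurable_int f1.
  by apply: measurableT_comp => //; exact/measurable_EFinP.
- apply: measurableT_comp => //; apply/measurable_EFinP.
  by apply: measurable_funM => //; exact: int1_measurable f1.
- by move=> x _ /=; rewrite -EFinM lee_fin normrM (ger0_norm (f_ge0 x)).
Qed.

Lemma Rintegral_density (g : T -> R) : measurable_fun [set: T] g ->
  int1 mu (fun x => g x * f x) ->
  \int[nu]_x g x = \int[mu]_x (g x * f x).
Proof.
move=> mg gf; rewrite /Rintegral; congr fine.
have mE : measurable_fun [set: T] (EFin \o g) by exact/measurable_EFinP.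
rewrite integralE [RHS]integralE.
rewrite ge0_integral_density//; last exact: measurable_funepos.
rewrite ge0_integral_density//; last exact: measurable_funeneg.
congr (_ - _)%E; apply: eq_integral => x _; rewrite unlock /=.
  by rewrite -!EFin_max -EFinM maxr_pMl// mul0r.
by rewrite -!EFin_max -EFinM maxr_pMl// mul0r mulNr.
Qed.

End density.

Section sample_mean.
Context {disp} {T : measurableType disp} {d'} {T' : measurableType d'} {R : realType}.
Variable P : probability T R.

Lemma sqint_int1 (g : T -> R) : sqint P g -> int1 P g.
Proof.
move=> [mg ig]; apply: (@int1_le _ _ _ _ _ (fun w => 1 + g w ^+ 2)) => //.
  by apply: int1D => //; exact: finite_measure_integrable_cst.
move=> w /=; rewrite [leRHS]ger0_norm ?addr_ge0 ?sqr_ge0//.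
rewrite -[X in _ + X]real_normK ?num_real//.
by have := sqr_ge0 (`|g w| - 1); have := normr_ge0 (g w); rewrite sqrrB1; lra.
Qed.

(** Independence says that the law of the pair is the product of the laws;
    Fubini does the rest. *)
Lemma independent_expectationM (Y Z : {RV P >-> T'}) (a : T' -> R) :
  (forall A B, measurable A -> measurable B ->
    P ((Y @^-1` A) `&` (Z @^-1` B)) = (P (Y @^-1` A) * P (Z @^-1` B))%E) ->
  measurable_fun [set: T'] a ->
  sqint P (a \o Y) -> sqint P (a \o Z) ->
  \int[P]_w (a (Y w) * a (Z w)) = \int[P]_w a (Y w) * \int[P]_w a (Z w).
Proof.
move=> ind ma sY sZ.
have intY : int1 P (a \o Y) by exact: sqint_int1.
have intZ : int1 P (a \o Z) by exact: sqint_int1.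
pose F (p : T' * T') := a p.1 * a p.2.
have mF : measurable_fun [set: T' * T'] (EFin \o F).
  by apply/measurable_EFinP; apply: measurable_funM; exact: measurableT_comp.
have mp : measurable_fun [set: T] (fun w => (Y w, Z w)).
  by apply: measurable_fun_pair.
pose pp : {measure set (T' * T') -> \bar R} :=
  measure_function_pushforward__canonical__measure_function_Measure P mp.
have ppE A : measurable A -> (distribution P Y \x distribution P Z)%E A = pp A.
  by move=> mA; apply: product_measure_unique => // B C mB mC; rewrite /pp /= -ind.
have iF : int1_prod (distribution P Y) (distribution P Z) F.
  have := integrable_pushforward mp mF (sqintM sY sZ) measurableT.
  move=> /integrableP[_ Foo]; apply/integrableP; split => //.
  by rewrite (eq_measure_integral pp) => [|A mA _]; last exact: ppE.
apply: EFin_inj; rewrite -int1_EFin; last exact: (sqintM sY sZ).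
transitivity (\int[pp]_z (F z)%:E)%E.
  by rewrite (integral_pushforward mp mF (sqintM sY sZ) measurableT).
transitivity (\int[distribution P Y \x distribution P Z]_z (F z)%:E)%E.
  by apply/esym; apply: eq_measure_integral => A mA _; exact: ppE.
rewrite -(Rfubini1 iF); congr EFin.
have maE : measurable_fun [set: T'] (EFin \o a) by exact/measurable_EFinP.
have dY : \int[distribution P Y]_x a x = \int[P]_w a (Y w).
  congr fine; exact: (integral_pushforward (measurable_funPT Y) maE intY measurableT).
have dZ : \int[distribution P Z]_x a x = \int[P]_w a (Z w).
  congr fine; exact: (integral_pushforward (measurable_funPT Z) maE intZ measurableT).
have iY' : int1 (distribution P Y) a.
  exact: (integrable_pushforward (measurable_funPT Y) maE intY measurableT).
have iZ' : int1 (distribution P Z) a.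
  exact: (integrable_pushforward (measurable_funPT Z) maE intZ measurableT).
rewrite -dY -dZ -RintegralZr//.
by apply: eq_Rintegral => y _; rewrite /F /= RintegralZl.
Qed.

(** In the double sum over i and j, the n diagonal terms contribute s and the
    n (n - 1) others m^2 each. *)
Lemma mse_sample_mean (X : nat -> {RV P >-> T'}) (a : T' -> R) (m s c : R) n :
  (forall i j A B, i != j -> measurable A -> measurable B ->
    P ((X i @^-1` A) `&` (X j @^-1` B)) = (P (X i @^-1` A) * P (X j @^-1` B))%E) ->
  measurable_fun [set: T'] a -> (forall i, sqint P (a \o X i)) ->
  (forall i, \int[P]_w a (X i w) = m) -> (forall i, \int[P]_w (a (X i w) ^+ 2) = s) ->
  (0 < n)%N ->
  (\int[P]_w ((n%:R^-1 * \sum_(i < n) a (X i w) - c) ^+ 2)%:E =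
   (n%:R^-1 * (s - m ^+ 2) + (m - c) ^+ 2)%:E)%E.
Proof.
move=> ind ma sX mE sE n0.
have n0R : n%:R != 0 :> R by rewrite pnatr_eq0 -lt0n.
have iX i : int1 P (fun w => a (X i w)) by exact: sqint_int1 (sX i).
have iXX i j : int1 P (fun w => a (X i w) * a (X j w)).
  exact: sqintM (sX i) (sX j).
have icst (k : R) : int1 P (fun=> k) by exact: finite_measure_integrable_cst.
have E w : (n%:R^-1 * \sum_(i < n) a (X i w) - c) ^+ 2 =
    n%:R^-1 ^+ 2 * (\sum_(i < n) \sum_(j < n) a (X i w) * a (X j w)) -
    (2 * c / n%:R) * \sum_(i < n) a (X i w) + c ^+ 2.
  have -> : \sum_(i < n) \sum_(j < n) a (X i w) * a (X j w) =
      (\sum_(i < n) a (X i w)) ^+ 2.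
    by rewrite expr2 mulr_suml; apply: eq_bigr => i _; rewrite mulr_sumr.
  by field.
have iss : int1 P (fun w => \sum_(i < n) \sum_(j < n) a (X i w) * a (X j w)).
  by apply: int1_sum => i; exact: int1_sum.
have is1 : int1 P (fun w => \sum_(i < n) a (X i w)) by exact: int1_sum.
rewrite int1_EFin; last first.
  under eq_fun do rewrite E.
  by apply: int1D => //; apply: int1B; exact: int1Z.
congr EFin; under eq_Rintegral do rewrite E.
rewrite (RintegralD measurableT (int1B (int1Z _ iss) (int1Z _ is1)) (icst _)).
rewrite (RintegralB measurableT (int1Z _ iss) (int1Z _ is1)).
rewrite (RintegralZl _ measurableT iss) (RintegralZl _ measurableT is1).
rewrite Rintegral_cst//.
rewrite (_ : fine (P setT) = 1); last by rewrite probability_setT.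
rewrite Rintegral_sum// => [|i]; last exact: int1_sum.
have -> : \sum_(i < n) \int[P]_w (\sum_(j < n) a (X i w) * a (X j w)) =
    n%:R * (s + (n%:R - 1) * m ^+ 2).
  transitivity (\sum_(i < n) (s + (n%:R - 1) * m ^+ 2)); last first.
    by rewrite sumr_const card_ord -[LHS]mulr_natl.
  apply: eq_bigr => i _; rewrite Rintegral_sum//.
  rewrite (bigD1 i)//=; congr (_ + _); first exact: sE.
  rewrite (eq_bigr (fun=> m ^+ 2)) => [|j ji].
    rewrite sumr_const -[LHS]mulr_natl; congr (_ * _).
    rewrite (_ : #|_| = n.-1); first by rewrite -subn1 natrB.
    by rewrite -[in RHS](card_ord n) -(cardC1 i); apply: eq_card => j.
  rewrite independent_expectationM// ?mE// => [A B mA mB].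
  apply: ind => //; apply/eqP => ij; move/eqP: ji; apply.
  exact/esym/val_inj.
rewrite Rintegral_sum// (eq_bigr (fun=> m)) => [|i _]; last exact: mE.
rewrite sumr_const card_ord -(mulr_natl m n).
by field.
Qed.

End sample_mean.

(** * Decomposition of the mean integrated squared error *)

Section mise.
Context {disp} {T : measurableType disp} {R : realType}.
Variable P : probability T R.
Context {d : nat}.
Local Notation rV := 'rV[R]_d.
Local Notation leb := (lebesgue_rV d).
Variables (X : nat -> {RV P >-> rV}) (f K : rV -> R).
Hypothesis X_indep : mutually_independent X.
Hypothesis f_ge0 : forall x, 0 <= f x.
Hypothesis X_density : forall i, has_density (X i) f.
Hypothesis K1 : int1 leb K.
Hypothesis K2 : sqint leb K.
Hypothesis f2 : sqint leb f.

Lemma density_mass : (\int[leb]_x (f x)%:E = 1)%E.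
Proof. by rewrite -(X_density 0 measurableT) probability_setT. Qed.

Lemma density_int1 : int1 leb f.
Proof. by apply: int1_ge0P => //; [case: f2|rewrite density_mass ltry]. Qed.

Lemma density_Rintegral1 : \int[leb]_x f x = 1.
Proof. by rewrite /Rintegral density_mass. Qed.

Lemma pairwise_independent i j (A B : set rV) : i != j ->
  measurable A -> measurable B ->
  P ((X i @^-1` A) `&` (X j @^-1` B)) = (P (X i @^-1` A) * P (X j @^-1` B))%E.
Proof.
move=> ij mA mB; pose C k := if k == i then A else B.
have us : uniq [:: i; j] by rewrite /= inE ij.
have mC k : measurable (C k) by rewrite /C; case: ifP.
have := @X_indep [:: i; j] C us mC.
rewrite big_cons big_seq1 {2 3}/C eqxx (eq_sym j) (negbTE ij) => E.
rewrite -E; congr (P _).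
apply/seteqP; split => w /=.
  move=> [Xi Xj] k /=; rewrite !inE => /orP[/eqP ->|/eqP ->]; rewrite /C ?eqxx//.
  by rewrite eq_sym (negbTE ij).
move=> H; split.
  by have := H i; rewrite /= !inE /C eqxx => /(_ isT).
by have := H j; rewrite /= !inE /C eqxx orbT eq_sym (negbTE ij) => /(_ isT).
Qed.

Lemma density_sample (g : rV -> R) i : measurable_fun [set: rV] g ->
  int1 leb (fun y => g y * f y) ->
  int1 P (fun w => g (X i w)) /\ \int[P]_w g (X i w) = \int[leb]_y (g y * f y).
Proof.
move=> mg gf; have mE : measurable_fun [set: rV] (EFin \o g) by exact/measurable_EFinP.
have nuE A : measurable A -> distribution P (X i) A = (\int[leb]_(x in A) (f x)%:E)%E.
  exact: X_density.
have iD : int1 (distribution P (X i)) g.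
  exact: (int1_density f_ge0 density_int1 nuE mg gf).
have iX : int1 P (fun w => g (X i w)).
  move: iD => /integrableP[_]; rewrite ge0_integral_distribution//; last first.
    exact: measurableT_comp.
  by move=> goo; apply/integrableP; split => //; apply/measurable_EFinP;
    exact: measurableT_comp.
split => //; rewrite -(Rintegral_density f_ge0 density_int1 nuE mg gf).
congr fine; apply/esym.
exact: (integral_pushforward (measurable_funPT (X i)) mE iX measurableT).
Qed.

Section bandwidth.
Variables (h : R) (n : nat).
Hypothesis h0 : 0 < h.
Hypothesis n0 : (0 < n)%N.

Let Kh (z : rV) : R := (h ^+ d)^-1 * K (h^-1 *: z).

Let hn0 : h != 0. Proof. exact: lt0r_neq0. Qed.
Let hi0 : h^-1 != 0. Proof. by rewrite invr_eq0. Qed.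
Let hd0 : 0 < h ^+ d. Proof. by rewrite exprn_gt0. Qed.

Let KhE z : Kh z = (h ^+ d)^-1 * K (h^-1 *: z + 0).
Proof. by rewrite addr0. Qed.

Let Kh1 : int1 leb Kh.
Proof.
rewrite (_ : Kh = fun z => (h ^+ d)^-1 * K (h^-1 *: z + 0)); last exact/funext.
by apply: int1Z; exact: int1_affine.
Qed.

Let Kh2 : sqint leb Kh.
Proof.
rewrite (_ : Kh = fun z => (h ^+ d)^-1 * K (h^-1 *: z + 0)); last exact/funext.
by apply: sqintZ; exact: sqint_affine.
Qed.

(** Squaring gives h^(-2d) and the substitution z = h u gives back h^d. *)
Lemma roughness_scaled : \int[leb]_z (Kh z ^+ 2) = roughness K / h ^+ d.
Proof.
have [_ KK] := K2.
under eq_Rintegral do rewrite KhE exprMn.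
rewrite RintegralZl//; last exact: (int1_affine 0 hi0 KK).
have <- : `|h^-1| ^+ d * \int[leb]_x (K (h^-1 *: x + 0) ^+ 2) = roughness K.
  exact: (Rintegral_affine 0 hi0 KK).
rewrite ger0_norm ?invr_ge0 ?(ltW h0)// (exprVn h d).
by field; exact: lt0r_neq0.
Qed.

(** Substitution y = x - h u. *)
Lemma kernel_mean x : int1 leb (fun y => Kh (x - y) * f y) ->
  \int[leb]_y (Kh (x - y) * f y) = kconv K f h x.
Proof.
move=> iF; have hN0 : - h != 0 by rewrite oppr_eq0.
rewrite -(Rintegral_affine x hN0 iF) normrN gtr0_norm//.
have := int1_affine x hN0 iF => iG.
rewrite -RintegralZl//; apply: eq_Rintegral => u _.
have -> : x - (- h *: u + x) = h *: u by rewrite opprD addrCA subrr addr0 scaleNr opprK.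
rewrite /Kh scalerA mulVf// scale1r mulrA mulrA divff ?lt0r_neq0// mul1r.
by rewrite scaleNr addrC.
Qed.

(** The second moment is the convolution of the integrable functions f and Kh^2:
    it is finite almost everywhere, but K may be unbounded, so that it can be
    infinite at some points. *)
Lemma ae_kernel_moments : {ae leb, forall x,
  int1 leb (fun y => Kh (x - y) * f y) /\ int1 leb (fun y => Kh (x - y) ^+ 2 * f y)}.
Proof.
have [_ KK] := Kh2.
have A := int1_prod_ae1 (int1_prod_conv 1 density_int1 Kh1).
have B := int1_prod_ae1 (int1_prod_conv 1 density_int1 KK).
apply: filterS2 A B => x /= Ax Bx; split.
  by under eq_fun do rewrite mulrC -[X in x - X]scale1r.
by under eq_fun do rewrite mulrC -[X in x - X]scale1r.
Qed.

Let s (x : rV) : R := \int[leb]_y (Kh (x - y) ^+ 2 * f y).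

Let sE x : s x = \int[leb]_y (f y * Kh (x - 1 *: y) ^+ 2).
Proof. by apply: eq_Rintegral => y _; rewrite scale1r mulrC. Qed.

Let s_int1 : int1 leb s.
Proof.
have [_ KK] := Kh2.
rewrite (_ : s = fun x => \int[leb]_y (f y * Kh (x - 1 *: y) ^+ 2)); last exact/funext.
exact: (int1_fubini1 (int1_prod_conv 1 density_int1 KK)).
Qed.

Let s_int : \int[leb]_x s x = roughness K / h ^+ d.
Proof.
have [_ KK] := Kh2.
under eq_Rintegral do rewrite sE.
rewrite (Rfubini (int1_prod_conv 1 density_int1 KK)) /=.
rewrite -[RHS]mul1r -[X in _ = X * _]density_Rintegral1 -roughness_scaled -RintegralZr//; last first.
  exact: density_int1.
apply: eq_Rintegral => y _.
have H := int1_shift (- (1 *: y)) KK.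
rewrite [LHS](RintegralZl (f y) measurableT H); congr (_ * _).
by rewrite (Rintegral_shift (- (1 *: y)) KK).
Qed.

Lemma kdeE (xs : nat -> rV) x :
  kde K h n xs x = n%:R^-1 * \sum_(i < n) Kh (x - xs i).
Proof.
by rewrite /kde invfM -mulrA mulr_sumr.
Qed.

(** Tonelli puts the expectation inside; pointwise the mean square error of a sample
    mean splits into variance and squared bias. *)
Lemma MISE_decomposition :
  MISE X K f h n = (roughness K / (n%:R * h ^+ d) +
    (\int[leb]_x ((kconv K f h x - f x) ^+ 2) -
     n%:R^-1 * \int[leb]_x (kconv K f h x ^+ 2)))%:E.
Proof.
have f1 := density_int1.
have [sk _] := kconv_young K1 f1 f2 h; have [mk kk] := sk.
have sb := sqintB sk f2; have [mb bb] := sb.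
have mKh := int1_measurable Kh1; have mf := int1_measurable f1.
rewrite /MISE.
pose G (p : T * rV) : \bar R := ((kde K h n (fun i => X i p.1) p.2 - f p.2) ^+ 2)%:E.
have mG : measurable_fun [set: T * rV] G.
  apply/measurable_EFinP; apply: measurable_funX; apply: measurable_funB; last first.
    exact: (measurableT_comp mf measurable_snd).
  under eq_fun do rewrite kdeE; apply: measurable_funM => //.
  apply: measurable_sum => i; apply: (measurableT_comp mKh).
  apply/measurable_fun_rVP => j; under eq_fun do rewrite !mxE.
  apply: measurable_funB.
    exact: (measurableT_comp (measurable_coord j) measurable_snd).
  apply: (measurableT_comp (measurable_coord j)).
  exact: (measurableT_comp (measurable_funPT (X i)) measurable_fst).
have G0 p : (0 <= G p)%E by rewrite lee_fin sqr_ge0.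
rewrite (fubini_tonelli G mG G0).
pose q x := n%:R^-1 * (s x - kconv K f h x ^+ 2) + (kconv K f h x - f x) ^+ 2.
have iq : int1 leb q by apply: int1D => //; apply: int1Z; exact: int1B.
transitivity (\int[leb]_x (q x)%:E)%E.
  apply: ae_eq_integral => //.
  - exact: (measurable_fun_fubini_tonelli_G G mG G0).
  - by apply/measurable_EFinP; exact: int1_measurable iq.
  apply: filterS ae_kernel_moments => x [i1 i2] _.
  rewrite /G /=; under eq_integral do rewrite kdeE.
  have ma : measurable_fun [set: rV] (fun y => Kh (x - y)).
    apply: measurableT_comp => //.
    rewrite (_ : (fun y => x - y) = fun y => -1 *: y + x).
      exact: measurable_affine.
    by apply/funext => y; rewrite scaleN1r addrC.
  have ma2 : measurable_fun [set: rV] (fun y => Kh (x - y) ^+ 2).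
    exact: measurable_funX.
  rewrite /q; apply: (@mse_sample_mean _ _ _ _ _ P X (fun y => Kh (x - y))
    (kconv K f h x) (s x) (f x) n _ ma) => //.
  - by move=> i j A B; exact: pairwise_independent.
  - move=> i; split; first exact: measurableT_comp.
    by have [] := density_sample i ma2 i2.
  - by move=> i; have [_ ->] := density_sample i ma i1; exact: kernel_mean.
  - by move=> i; have [_ ->] := density_sample i ma2 i2.
rewrite int1_EFin//; congr EFin.
have ib : int1 leb (fun x => s x - kconv K f h x ^+ 2) by exact: int1B.
rewrite (RintegralD measurableT (int1Z _ ib) bb) (RintegralZl _ measurableT ib).
rewrite RintegralB// s_int.
by field; rewrite !lt0r_neq0// ltr0n.
Qed.

End bandwidth.

End mise.

(** * Asymptotic expansion *)

Section asymptotics.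
Context {R : realType} {d : nat}.
Local Notation rV := 'rV[R]_d.
Local Notation leb := (lebesgue_rV d).

Lemma measurable_enorm_sqr : measurable_fun [set: rV] (fun u : rV => enorm u ^+ 2).
Proof.
have -> : (fun u : rV => enorm u ^+ 2) = fun u => \sum_(i < d) u ord0 i ^+ 2.
  by apply/funext => u; rewrite sqr_sqrtr// sumr_ge0// => i _; exact: sqr_ge0.
by apply: measurable_sum => i; apply: measurable_funX; exact: measurable_coord.
Qed.

(** |b|^2 - |l|^2 = |b - l|^2 + 2 <b - l, l>. *)
Lemma dist_sqr_nrm2 (b l : rV -> R) : sqint leb b -> sqint leb l ->
  `|\int[leb]_x (b x ^+ 2) - \int[leb]_x (l x ^+ 2)| <=
  nrm2 leb (fun x => b x - l x) *
    (nrm2 leb (fun x => b x - l x) + 2 * nrm2 leb l).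
Proof.
move=> sb sl; have sq := sqintB sb sl.
have -> : \int[leb]_x (b x ^+ 2) - \int[leb]_x (l x ^+ 2) =
    nrm2 leb (fun x => b x - l x) ^+ 2 + 2 * \int[leb]_x ((b x - l x) * l x).
  have := RintegralDsq 1 sq sl.
  have -> : (fun x => (b x - l x + 1 * l x) ^+ 2) = (fun x => b x ^+ 2).
    by apply/funext => x; rewrite mul1r subrK.
  by rewrite nrm2_sqr expr1n mulr1 mul1r => ->; rewrite addrK.
rewrite (le_trans (ler_normD _ _))// mulrDr; apply: lerD.
  by rewrite ger0_norm ?sqr_ge0// expr2.
rewrite normrM ger0_norm// mulrCA ler_wpM2l//.
exact: cauchy_schwarz_nrm2.
Qed.

End asymptotics.

Theorem theorem6p4 (R : realType) (d : nat) (hd : (0 < d)%N)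
    (disp : measure_display) (T : measurableType disp) (P : probability T R)
    (X : nat -> {RV P >-> 'rV[R]_d}) (f K : 'rV[R]_d -> R)
    (D2f : 'rV[R]_d -> 'M[R]_d) (h : nat -> R)
    (X_indep : mutually_independent X)
    (f_ge0 : forall x, 0 <= f x)
    (X_density : forall i, has_density (X i) f)
    (K_L1 : K \in Lfun (lebesgue_rV d) 1%E)
    (K_L2 : K \in Lfun (lebesgue_rV d) 2%:E)
    (K_int1 : \int[lebesgue_rV d]_u K u = 1)
    (K_mean0 : \row_i \int[lebesgue_rV d]_u (u ord0 i * K u) = 0)
    (K_moment2 :
      (\int[lebesgue_rV d]_u (enorm u ^+ 2 * `|K u|)%:E < +oo)%E)
    (f_C11 : C11 f)
    (f_L2 : f \in Lfun (lebesgue_rV d) 2%:E)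
    (f_hessian : weak_hessian f D2f)
    (D2f_L2 : forall i j, (fun x => D2f x i j) \in Lfun (lebesgue_rV d) 2%:E)
    (h_gt0 : forall n, (0 < n)%N -> 0 < h n)
    (h_cvg0 : h n @[n --> \oo] --> 0)
    (nhd_cvg : n%:R * h n ^+ d @[n --> \oo] --> +oo) :
  exists r : nat -> R,
    r =o_\oo (fun n => h n ^+ 4 + (n%:R * h n ^+ d)^-1) /\
    \forall n \near \oo,
      MISE X K f (h n) n =
      ((h n ^+ 4 / 4)%:E *
         'N[lebesgue_rV d]_2%:E[EFin \o LK K D2f] ^+ 2 +
       (roughness K / (n%:R * h n ^+ d))%:E + (r n)%:E)%E.
Proof.
pose leb := lebesgue_rV (R := R) d.
have K1 : int1 leb K by exact/Lfun1_integrable.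
have K2 : sqint leb K by exact: Lfun2_sqint.
have f2 : sqint leb f by exact: Lfun2_sqint.
have D2 i j : sqint leb (fun x => D2f x i j) by exact: Lfun2_sqint.
have f1 : int1 leb f by exact: (density_int1 f_ge0 X_density f2).
have Kmean i : \int[leb]_u (u ord0 i * K u) = 0.
  by have /rowP/(_ i) := K_mean0; rewrite !mxE.
have Kmom : int1 leb (fun u => enorm u ^+ 2 * `|K u|).
  apply: int1_ge0P => //; last by move=> u; rewrite mulr_ge0 ?sqr_ge0.
  apply: measurable_funM; first exact: measurable_enorm_sqr.
  by apply: measurableT_comp => //; exact: int1_measurable K1.
have sL := sqint_LK K D2.
pose L := LK K D2f.
(* the variance lost to the square of the mean, and the error in the bias *)
pose r n := \int[leb]_x ((kconv K f (h n) x - f x) ^+ 2) -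
  h n ^+ 4 / 4 * \int[leb]_x (L x ^+ 2) - n%:R^-1 * \int[leb]_x (kconv K f (h n) x ^+ 2).
exists r; split; last first.
  near=> n; have n0 : (0 < n)%N by near: n; exact: nbhs_infty_gt.
  rewrite (MISE_decomposition X_indep f_ge0 X_density K1 K2 f2 (h_gt0 n n0) n0).
  rewrite Lnorm2_sqr// -EFinM -!EFinD; congr EFin.
  by rewrite /r -/leb -/L; ring.
apply/eqoP => e e0.
pose NL := nrm2 leb L; have NL0 : 0 <= NL by exact: nrm2_ge0.
(* e1 <= 1 makes e1^2 + e1 |L| at most e1 (1 + |L|), hence at most e *)
pose e1 := Num.min 1 (e / (1 + NL)).
have NL1 : 0 < 1 + NL by rewrite ltr_wpDr.
have e10 : 0 < e1 by rewrite lt_min ltr01 divr_gt0.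
have [eta eta0 Heta] := bias_expansion K1 K_int1 Kmean Kmom f1 f2 f_hessian D2 e10.
pose C := (\int[leb]_u `|K u|) ^+ 2 * \int[leb]_x (f x ^+ 2).
have C0 : 0 <= C by rewrite mulr_ge0 ?sqr_ge0 ?Rintegral_sqr_ge0.
have C1 : 0 < C + 1 by rewrite ltr_wpDl.
have hn_small a : 0 < a -> \forall n \near \oo, h n < a.
  by move=> a0; apply: (cvgr_lt _ h_cvg0).
near=> n.
have n0 : (0 < n)%N by near: n; exact: nbhs_infty_gt.
have hn0 := h_gt0 n n0.
have hn_eta : h n < eta by near: n; exact: hn_small.
have hn1 : h n < 1 by near: n; exact: hn_small.
have hnC : h n < e / (C + 1) by near: n; apply: hn_small; rewrite divr_gt0.
have [sk kC] := kconv_young K1 f1 f2 (h n).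
have sb := sqintB sk f2.
have sl : sqint leb (fun x => h n ^+ 2 / 2 * L x) by exact: sqintZ.
have hd0 : 0 < h n ^+ d by rewrite exprn_gt0.
have nR : 0 < n%:R :> R by rewrite ltr0n.
rewrite [leRHS](_ : _ = e * h n ^+ 4 + e * (n%:R * h n ^+ d)^-1); last first.
  by rewrite ger0_norm ?mulrDr// addr_ge0 ?exprn_ge0 ?(ltW hn0)// invr_ge0 ltW ?mulr_gt0.
rewrite /r (le_trans (ler_normB _ _))//; apply: lerD.
  have -> : h n ^+ 4 / 4 * \int[leb]_x (L x ^+ 2) =
      \int[leb]_x ((h n ^+ 2 / 2 * L x) ^+ 2).
    under [RHS]eq_Rintegral do rewrite exprMn.
    by rewrite RintegralZl//; [field|case: sL].
  apply: (le_trans (dist_sqr_nrm2 sb sl)).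
  have -> : nrm2 leb (fun x => h n ^+ 2 / 2 * L x) = h n ^+ 2 / 2 * NL.
    rewrite /nrm2; under eq_Rintegral do rewrite exprMn.
    rewrite RintegralZl//; last by case: sL.
    by rewrite sqrtrM ?sqr_ge0// sqrtr_sqr ger0_norm// divr_ge0// sqr_ge0.
  have := Heta _ hn0 hn_eta.
  rewrite -/(bias_error K f D2f (h n)).
  set Q := nrm2 leb _; have Q0 : 0 <= Q by exact: nrm2_ge0.
  have h20 : 0 <= h n ^+ 2 by exact: sqr_ge0.
  move=> Qh.
  have e1_1 : e1 <= 1 by rewrite /e1 ge_min lexx.
  have e1e : e1 * (1 + NL) <= e by rewrite -ler_pdivlMr// /e1 ge_min lexx orbT.
  apply: (@le_trans _ _ ((e1 * h n ^+ 2) * (h n ^+ 2 * (1 + NL)))).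
    apply: ler_pM => //.
      by rewrite addr_ge0// mulr_ge0// mulr_ge0// divr_ge0.
    have : e1 * h n ^+ 2 <= h n ^+ 2 by rewrite ler_piMl.
    by move: Qh; lra.
  have -> : e1 * h n ^+ 2 * (h n ^+ 2 * (1 + NL)) = e1 * (1 + NL) * h n ^+ 4 by ring.
  by rewrite ler_wpM2r// exprn_ge0// ltW.
rewrite ger0_norm ?mulr_ge0 ?invr_ge0 ?(ltW nR) ?Rintegral_sqr_ge0//.
apply: (@le_trans _ _ (n%:R^-1 * C)); first by rewrite ler_wpM2l// invr_ge0 ltW.
have -> : e * (n%:R * h n ^+ d)^-1 = n%:R^-1 * (e / h n ^+ d).
  by rewrite invfM mulrCA.
rewrite ler_wpM2l ?invr_ge0 ?(ltW nR)//.
rewrite ler_pdivlMr//.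
(* 1 / n is h^d times 1 / (n h^d), and h^d <= h because d > 0 and h < 1 *)
have hdh : h n ^+ d <= h n.
  by case: (d) hd => // d' _; rewrite exprS ler_piMr ?(ltW hn0)// exprn_ile1// ltW.
apply: (@le_trans _ _ (C * (e / (C + 1)))).
  by rewrite ler_wpM2l// (le_trans hdh)// ltW.
by rewrite mulrA ler_pdivrMr// mulrC ler_wpM2l ?(ltW e0)// lerDl.
Unshelve. all: by end_near.
Qed.
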